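(* Let $\mathscr{A}$ be a unital $C^*$-algebra, $\mathscr{E}$ a Hilbert $\mathscr{A}$-module, and $\mathscr{E}_1,\mathscr{E}_2$ ternary subspaces of $\mathscr{E}$. Then $\mathscr{E}_1$ and $\mathscr{E}_2$ are module independent if and only if there are positive constants $m$ and $M$ such that for every pair of pure states $\varphi_1$ on $\langle\mathscr{E}_1,\mathscr{E}_1\rangle$ and $\varphi_2$ on $\langle\mathscr{E}_2,\mathscr{E}_2\rangle$ there is a state $\varphi$ on $\mathscr{A}$ with $$m\,\varphi_i(|x|)\le\varphi(|x|)\le M\,\varphi_i(|x|^2)^{1/2}\qquad\text{for all }x\in\mathscr{E}_i,\ i=1,2.$$
   Context: A state on a $C^*$-algebra is a positive linear functional of norm one; $S(\mathscr{B})$ is the set of states of $\mathscr{B}$. Hilbert $C^*$-modules are right modules with $\mathscr{A}$-valued inner product $\langle\cdot,\cdot\rangle$, $\mathscr{A}$-linear in the second variable, and $\|x\|=\|\langle x,x\rangle\|^{1/2}$; for $x\in\mathscr{E}$, $|x|=\langle x,x\rangle^{1/2}\in\mathscr{A}$. For a closed subspace $\mathscr{F}\subseteq\mathscr{E}$, $\langle\mathscr{F},\mathscr{F}\rangle$ is the closed linear span of $\{\langle x,y\rangle:x,y\in\mathscr{F}\}$. A closed subspace $\mathscr{F}$ of $\mathscr{E}$ is ternary if $\mathscr{F}\langle\mathscr{F},\mathscr{F}\rangle\subseteq\mathscr{F}$; then $\langle\mathscr{F},\mathscr{F}\rangle$ is a $C^*$-subalgebra of $\mathscr{A}$. Ternary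 subspaces $\mathscr{E}_1,\mathscr{E}_2$ of $\mathscr{E}$ are (Hilbert $C^*$-)module independent if there are constants $m,M>0$ such that for all states $\varphi_i\in S(\langle\mathscr{E}_i,\mathscr{E}_i\rangle)$, $i=1,2$, there is a state $\varphi\in S(\mathscr{A})$ with $m\,\varphi_i(|x|)\le\varphi(|x|)\le M\,\varphi_i(|x|^2)^{1/2}$ for all $x\in\mathscr{E}_i$, $i=1,2$. *)

(* Defs.v *)
From HB Require Import structures.
From mathcomp Require Import all_boot all_order all_algebra.
From mathcomp Require Import complex.
From mathcomp Require Import all_classical all_reals all_analysis.

Set Implicit Arguments.
Unset Strict Implicit.
Unset Printing Implicit Defensive.

Import Order.TTheory GRing.Theory Num.Theory.
Import numFieldNormedType.Exports.

Local Open Scope classical_set_scope.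
Local Open Scope complex_scope.
Local Open Scope ring_scope.

(* Norms of [normedModType R[i]] take their values in [R[i]]; there
   [x <= y] means that [y - x] is a nonnegative real number. *)

(* The library's norm structures join with its ring structures only through
   [numDomainType], so the (unital) product is a field of the mixin; [cmul] is
   written [**] below. *)
HB.mixin Record isCStar (R : realType) A & CompleteNormedModule R[i] A := {
  cmul : A -> A -> A;
  cone : A;
  cmulA : forall a b c, cmul a (cmul b c) = cmul (cmul a b) c;
  cmul1l : forall a, cmul cone a = a;
  cmul1r : forall a, cmul a cone = a;
  cmulDl : forall a b c, cmul (a + b) c = cmul a c + cmul b c;
  cmulDr : forall a b c, cmul a (b + c) = cmul a b + cmul a c;
  cmulZl : forall (l : R[i]) a b, cmul (l *: a) b = l *: cmul a b;
  cmulZr : forall (l : R[i]) a b, cmul a (l *: b) = l *: cmul a b;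
  star : A -> A;
  starK : forall a, star (star a) = a;
  starD : forall a b, star (a + b) = star a + star b;
  starZ : forall (l : R[i]) a, star (l *: a) = l^* *: star a;
  starM : forall a b, star (cmul a b) = cmul (star b) (star a);
  cnormM : forall a b : A, `|cmul a b| <= `|a| * `|b|;
  cnorm_star : forall a : A, `|cmul (star a) a| = `|a| ^+ 2
}.

#[short(type="cstarAlgType")]
HB.structure Definition CStarAlgebra (R : realType) :=
  {A of CompleteNormedModule R[i] A & isCStar R A}.

Notation "a ** b" := (cmul a b) (at level 40, left associativity) : ring_scope.

Section Elements.
Context {R : realType} {A : cstarAlgType R}.

Definition spectrum (a : A) : set R[i] :=
  [set l | ~ exists b, b ** (a - l *: cone) = cone /\ (a - l *: cone) ** b = cone].

Definition positive_elt (a : A) : Prop :=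
  star a = a /\ forall l, spectrum a l -> 0 <= l.

(* The unique positive square root of a positive element. *)
Definition cstar_sqrt (a : A) : A :=
  xget 0 [set p | positive_elt p /\ p ** p = a].

End Elements.

(* The right action of A on E is [ract]: the library's [lmodType] only has
   left actions, and that of R[i] on E is already one. *)
HB.mixin Record isHilbertModule (R : realType) (A : cstarAlgType R) E
    & CompleteNormedModule R[i] E := {
  ract : E -> A -> E;
  ractDl : forall x y a, ract (x + y) a = ract x a + ract y a;
  ractDr : forall x a b, ract x (a + b) = ract x a + ract x b;
  ractA : forall x a b, ract (ract x a) b = ract x (a ** b);
  ract1 : forall x, ract x cone = x;
  ractZl : forall (c : R[i]) x a, ract (c *: x) a = c *: ract x a;
  ractZr : forall (c : R[i]) x a, ract x (c *: a) = c *: ract x a;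
  inner : E -> E -> A;
  innerDr : forall x y z, inner x (y + z) = inner x y + inner x z;
  innerZr : forall (c : R[i]) x y, inner x (c *: y) = c *: inner x y;
  inner_ract : forall x y a, inner x (ract y a) = inner x y ** a;
  inner_star : forall x y, star (inner x y) = inner y x;
  inner_ge0 : forall x, positive_elt (inner x x);
  inner_eq0 : forall x, inner x x = 0 -> x = 0;
  hilbert_norm : forall x : E, `|x| = sqrtC `|inner x x|
}.

#[short(type="hilbertModType")]
HB.structure Definition HilbertModule (R : realType) (A : cstarAlgType R) :=
  {E of CompleteNormedModule R[i] E & isHilbertModule R A E}.

Definition is_subspace {K : numFieldType} {V : lmodType K} (F : set V) : Prop :=
  F 0 /\ forall (c : K) x y, F x -> F y -> F (c *: x + y).

Definition closed_span {K : numFieldType} {V : normedModType K} (S : set V) :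
    set V :=
  closure (smallest (@is_subspace K V) S).

Section States.
Context {R : realType} {A : cstarAlgType R}.

(* Functionals on a C*-subalgebra [B] of [A] are represented by functions on
   [A] of which only the values on [B] matter. *)
Variable B : set A.
Implicit Types phi psi : A -> R[i].

Definition linear_on phi : Prop :=
  forall (c : R[i]) a b, B a -> B b -> phi (c *: a + b) = c * phi a + phi b.

Definition positive_on phi : Prop :=
  forall b, B b -> 0 <= phi (star b ** b).

Definition functional_norm phi : \bar R :=
  ereal_sup [set (Normc.normc (phi b))%:E | b in [set b | B b /\ `|b| <= 1]].

Definition state phi : Prop :=
  [/\ linear_on phi, positive_on phi & functional_norm phi = 1%E].

(* Pure states are the extreme points of the set of states of [B]. *)
Definition pure_state phi : Prop :=
  state phi /\
  forall (psi1 psi2 : A -> R[i]) (t : R),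
    state psi1 -> state psi2 -> 0 < t < 1 ->
    (forall b, B b -> phi b = t%:C * psi1 b + (1 - t)%:C * psi2 b) ->
    forall b, B b -> psi1 b = phi b /\ psi2 b = phi b.

End States.

Section HilbertModules.
Context {R : realType} {A : cstarAlgType R} {E : hilbertModType A}.

Definition module_abs (x : E) : A := cstar_sqrt (inner x x).

Definition inner_span (F : set E) : set A :=
  closed_span [set inner z.1 z.2 | z in F `*` F].

Definition ternary (F : set E) : Prop :=
  [/\ is_subspace F, closed F &
      forall x a, F x -> inner_span F a -> F (ract x a)].

Definition state_sandwich (m M : R) (F : set E) (phiF phi : A -> R[i]) : Prop :=
  forall x, F x ->
    m%:C * phiF (module_abs x) <= phi (module_abs x) /\
    phi (module_abs x) <= M%:C * sqrtC (phiF (module_abs x ** module_abs x)).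

Definition module_independent (E1 E2 : set E) : Prop :=
  exists m M : R, [/\ 0 < m, 0 < M &
    forall phi1 phi2 : A -> R[i],
      state (inner_span E1) phi1 -> state (inner_span E2) phi2 ->
      exists phi : A -> R[i],
        [/\ state [set: A] phi,
            state_sandwich m M E1 phi1 phi & state_sandwich m M E2 phi2 phi]].

End HilbertModules.

(* Main.v *)
Require Import Defs.
From mathcomp Require Import all_boot all_order all_algebra.
From mathcomp Require Import complex.
From mathcomp Require Import all_classical all_reals all_analysis.
From mathcomp Require Import ring lra.

Import Order.TTheory GRing.Theory Num.Theory.
Import numFieldNormedType.Exports.

Local Open Scope classical_set_scope.
Local Open Scope complex_scope.
Local Open Scope ring_scope.

(** Fix a state on the first algebra and approximate it by convex combinations
    of pure states: since [sqrt] is concave, the sandwich inequalities pass to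
    convex combinations of the states on both sides, and to pointwise limits,
    the states of the unital algebra [A] being compact.  Doing this first in one
    variable and then in the other gives the result with the same constants.

    The approximation is Krein-Milman for the pointwise compact set of
    quasi-states.  It concerns the values [phi (module_abs x)], so one needs
    [module_abs x] to lie in the (possibly non-unital) algebra [inner_span F].
    That is shown without spectral radius or functional calculus: square roots
    are limits of polynomials, and for commuting self-adjoint [g], [j] the
    C*-identity for [g + 'i j] gives [`|j| ^ 2 <= `|g ^ 2 + j ^ 2|]. *)

Local Notation reC := (@complex.Re _).
Local Notation imC := (@complex.Im _).

(** * Square roots in closed subalgebras *)

Section SquareRoots.
Context {R : realType} {A : cstarAlgType R}.
Implicit Types (a b c g j p q x y : A) (B : set A).

Lemma cmul0l a : 0 ** a = 0.
Proof. by rewrite -(scale0r (0 : A)) cmulZl !scale0r. Qed.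

Lemma cmul0r a : a ** 0 = 0.
Proof. by rewrite -(scale0r (0 : A)) cmulZr !scale0r. Qed.

Lemma cmulNl a b : (- a) ** b = - (a ** b).
Proof. by rewrite -scaleN1r cmulZl scaleN1r. Qed.

Lemma cmulNr a b : a ** (- b) = - (a ** b).
Proof. by rewrite -scaleN1r cmulZr scaleN1r. Qed.

Lemma cmulBl a b c : (a - b) ** c = a ** c - b ** c.
Proof. by rewrite cmulDl cmulNl. Qed.

Lemma cmulBr a b c : a ** (b - c) = a ** b - a ** c.
Proof. by rewrite cmulDr cmulNr. Qed.

Lemma starN a : star (- a) = - star a.
Proof. by rewrite -scaleN1r starZ rmorphN rmorph1 scaleN1r. Qed.

Lemma starB a b : star (a - b) = star a - star b.
Proof. by rewrite starD starN. Qed.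

Lemma star0 : star (0 : A) = 0.
Proof. by have := starB 0 0; rewrite !subrr. Qed.

Lemma star_cone : star (cone : A) = cone.
Proof.
by rewrite -[LHS]cmul1r -[X in _ ** X]starK -starM cmul1r starK.
Qed.

Lemma norm_star a : `|star a| = `|a|.
Proof.
suff H b : `|b| <= `|star b|.
  by apply/eqP; rewrite eq_le H andbT -{2}(starK a) H.
have [->|b0] := eqVneq b 0; first by rewrite normr0.
rewrite -(ler_pM2r (_ : 0 < `|b|)) ?normr_gt0// -expr2 -cnorm_star.
exact: cnormM.
Qed.

(** The C*-identity makes this norm idempotent, hence [0] or [1]; it is [0] in the zero algebra. *)
Lemma norm_cone : `|cone : A| <= 1.
Proof.
have := cnorm_star (cone : A); rewrite star_cone cmul1l => /eqP.
rewrite expr2 -subr_eq0 -{1}[`|_|]mulr1 -mulrBr mulf_eq0 => /orP[/eqP->//|].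
by rewrite subr_eq0 => /eqP <-.
Qed.

Lemma norm_sqr_sa a : star a = a -> `|a ** a| = `|a| ^+ 2.
Proof. by move=> sa; rewrite -cnorm_star sa. Qed.

(* [star w ** w = g ** g + j ** j] for [w = g + 'i j], and [j] is the imaginary
   part of [w]. *)
Lemma norm_sqr_le_add g j : star g = g -> star j = j -> g ** j = j ** g ->
  `|j| ^+ 2 <= `|g ** g + j ** j|.
Proof.
move=> sg sj gj; pose w := g + 'i *: j.
have sw : star w = g - 'i *: j by rewrite starD starZ sg sj conjCi scaleNr.
have -> : g ** g + j ** j = star w ** w.
  rewrite sw cmulDr !cmulBl !cmulZl !cmulZr gj scalerA -expr2 sqrCi.
  by rewrite scaleN1r opprK addrA subrK.
rewrite cnorm_star lerXn2r ?nnegrE//.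
have e : (2 * 'i) *: j = w - star w.
  by rewrite sw /w opprB addrCA [g + _]addrC addrK mulr_natl mulr2n scalerDl.
have : `|(2 * 'i) *: j| <= 2 * `|w|.
  rewrite e (le_trans (ler_normB _ _))// norm_star.
  by rewrite mulr_natl mulr2n.
by rewrite normrZ normrM normCi mulr1 normr_nat ler_pM2l// ltr0n.
Qed.


Lemma cvgn_dominated (u : nat -> A) (v : nat -> R) : cvgn v ->
  (forall m n, (m <= n)%N -> `|u n - u m| <= (v n - v m)%:C) -> cvgn u.
Proof.
move=> cv uv.
apply: cauchy_cvg; apply: cauchy_exP => e e0.
have er : e = (reC e)%:C by rewrite RRe_real// gtr0_real.
have re0 : 0 < reC e / 2.
  by rewrite divr_gt0// -ltcR -er.
have /cvgrPdist_lt/(_ _ re0)[N _ HN] := cv.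
exists (u N); exists N => //= n /= Nn.
rewrite -ball_normE /= distrC (le_lt_trans (uv _ _ Nn))// er ltcR.
have := HN _ (leqnn N); have := HN _ Nn => /=.
rewrite !ltr_norml => /andP[a1 a2] /andP[a3 a4].
lra.
Qed.

(** Carries self-adjointness and commutation from the iterates of the square root to their limit. *)
Lemma lipschitz_cvg_zero (f : A -> A) (K : R[i]) (u : nat -> A) l : 0 <= K ->
  (forall x y, `|f x - f y| <= K * `|x - y|) -> u @ \oo --> l ->
  (forall n, f (u n) = 0) -> f l = 0.
Proof.
move=> K0 fK ul fu; apply/eqP; rewrite -normr_eq0; apply/eqP/le_anti.
rewrite normr_ge0 andbT; apply/ler_addgt0Pr => e e0; rewrite add0r.
have eK : 0 < e / (K + 1) by rewrite divr_gt0// ltr_wpDl.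
have /cvgrPdist_lt/(_ _ eK)[N _ HN] := ul.
have /ltW uN := HN _ (leqnn N).
rewrite -[f l]subr0 -(fu N) (le_trans (fK _ _))//.
rewrite (le_trans (ler_wpM2l K0 uN))// mulrCA ger_pMr// ler_pdivrMr ?mul1r ?lerDl//.
by rewrite ltr_wpDl.
Qed.

Lemma closed_cvgn (B : set A) (u : nat -> A) l : closed B -> u @ \oo --> l ->
  (forall n, B (u n)) -> B l.
Proof. by move=> cB ul uB; apply: (closed_cvg B cB _ l ul); near=> n; exact: uB.
Unshelve. all: by end_near. Qed.

(** This is [sqrt_iter] run on scalars with [z = 1]. *)
Fixpoint sqrt_bound (n : nat) : R :=
  if n is n'.+1 then (1 + sqrt_bound n' ^+ 2) / 2 else 0.

Lemma sqrt_bound_itv n : 0 <= sqrt_bound n <= 1.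
Proof.
elim: n => [|n /andP[h0 h1]] /=; first by rewrite lexx ler01.
by apply/andP; split; nra.
Qed.

Lemma sqrt_bound_leS n : sqrt_bound n <= sqrt_bound n.+1.
Proof. by rewrite /=; have := sqr_ge0 (sqrt_bound n - 1); nra. Qed.

Lemma sqrt_bound_nd : {homo sqrt_bound : n m / (n <= m)%N >-> n <= m}.
Proof. by apply/nondecreasing_seqP => n; exact: sqrt_bound_leS. Qed.

Lemma sqrt_bound_cvg1 : sqrt_bound @ \oo --> (1 : R).
Proof.
have c : cvgn sqrt_bound.
  apply: nondecreasing_is_cvgn; first exact: sqrt_bound_nd.
  by exists 1 => _ [n _ <-]; have /andP[] := sqrt_bound_itv n.
have cS : (fun n => sqrt_bound n.+1) @ \oo --> limn sqrt_bound.
  by rewrite (cvg_shiftS sqrt_bound).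
have cF : (fun n => sqrt_bound n.+1) @ \oo --> (1 + limn sqrt_bound ^+ 2) / 2.
  apply: cvgMl; apply: cvgD; first exact: cvg_cst.
  by rewrite expr2; apply: cvgM.
have e := cvg_unique (@Rhausdorff R) cS cF.
suff <- : limn sqrt_bound = 1 by [].
move: (limn _) e => l e.
have : (l - 1) ^+ 2 = 0 by rewrite sqrrB1 {2}e; field.
by move=> /eqP; rewrite sqrf_eq0 subr_eq0 => /eqP.
Qed.

(** A fixed point [l] satisfies [(1 - l) ^ 2 = 1 - z], so [z = 1 - x] leads to the square root
    [1 - l] of [x]. *)
Fixpoint sqrt_iter (z : A) (n : nat) : A :=
  if n is n'.+1 then 2^-1 *: (z + sqrt_iter z n' ** sqrt_iter z n') else 0.

Lemma le_half_norm (t : R) x : `|x| <= (2 * t)%:C -> `|2^-1 *: x| <= t%:C.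
Proof.
rewrite normrZ normfV normr_nat ler_pdivrMl ?ltr0n//.
by rewrite rmorphM rmorph_nat.
Qed.

Lemma norm_sqrt_iter z n : `|z| <= 1 -> `|sqrt_iter z n| <= (sqrt_bound n)%:C.
Proof.
move=> z1; elim: n => [|n IH]; first by rewrite normr0.
apply: le_half_norm; rewrite mulrC divfK//.
rewrite rmorphD rmorph1 rmorphXn (le_trans (ler_normD _ _))// lerD//.
by rewrite (le_trans (cnormM _ _))// -expr2 lerXn2r ?nnegrE// (le_trans _ IH).
Qed.

(** Writing [u ** u - v ** v = u ** (u - v) + (u - v) ** v] bounds each increment by the previous
    one, and the increments of [sqrt_bound] obey the same recursion with equality. *)
Lemma sqrt_iter_dist z m n : `|z| <= 1 -> (m <= n)%N ->
  `|sqrt_iter z n - sqrt_iter z m| <= (sqrt_bound n - sqrt_bound m)%:C.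
Proof.
move=> z1; have step k : `|sqrt_iter z k.+1 - sqrt_iter z k|
    <= (sqrt_bound k.+1 - sqrt_bound k)%:C.
  elim: k => [|k IH].
    rewrite subr0 subr0; exact: norm_sqrt_iter z 1 z1.
  rewrite [X in X - _]/= [X in _ - X]/= -scalerBr; apply: le_half_norm.
  set u := sqrt_iter z k.+1; set v := sqrt_iter z k.
  have -> : z + u ** u - (z + v ** v) = u ** (u - v) + (u - v) ** v.
    by rewrite cmulBr cmulBl opprD addrACA subrr add0r addrA subrK.
  have -> : 2 * (sqrt_bound k.+2 - sqrt_bound k.+1) =
      sqrt_bound k.+1 * (sqrt_bound k.+1 - sqrt_bound k)
      + (sqrt_bound k.+1 - sqrt_bound k) * sqrt_bound k.
    have : 2 * sqrt_bound k.+1 = 1 + sqrt_bound k ^+ 2 by rewrite mulrC divfK.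
    have : 2 * sqrt_bound k.+2 = 1 + sqrt_bound k.+1 ^+ 2 by rewrite mulrC divfK.
    move: (sqrt_bound k.+2) (sqrt_bound k.+1) (sqrt_bound k); clear.
    by move=> ? ? ?; nra.
  move: (norm_sqrt_iter z k.+1 z1) (norm_sqrt_iter z k z1) IH.
  rewrite -/u -/v; move: (sqrt_bound k.+1) (sqrt_bound k) => s t us vt IH.
  rewrite rmorphD !rmorphM (le_trans (ler_normD _ _))// lerD//.
    by rewrite (le_trans (cnormM _ _))// ler_pM.
  by rewrite (le_trans (cnormM _ _))// ler_pM.
elim: n => [|n IH]; first by rewrite leqn0 => /eqP ->; rewrite !subrr normr0.
rewrite leq_eqVlt => /predU1P[->|]; first by rewrite !subrr normr0.
rewrite ltnS => /IH h.
have -> : sqrt_iter z n.+1 - sqrt_iter z m =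
    (sqrt_iter z n.+1 - sqrt_iter z n) + (sqrt_iter z n - sqrt_iter z m).
  by rewrite addrA subrK.
have -> : sqrt_bound n.+1 - sqrt_bound m =
    (sqrt_bound n.+1 - sqrt_bound n) + (sqrt_bound n - sqrt_bound m).
  by rewrite addrA subrK.
by rewrite rmorphD (le_trans (ler_normD _ _))// lerD.
Qed.

Definition closed_subalgebra B :=
  [/\ is_subspace B, closed B & forall a b, B a -> B b -> B (a ** b)].

Lemma subspaceD (V : lmodType R[i]) (F : set V) u v :
  is_subspace F -> F u -> F v -> F (u + v).
Proof. by move=> [_ h] Fu Fv; rewrite -[u]scale1r; exact: h. Qed.

Lemma subspaceZ (V : lmodType R[i]) (F : set V) (k : R[i]) u :
  is_subspace F -> F u -> F (k *: u).
Proof. by move=> [F0 h] Fu; rewrite -[k *: u]addr0; exact: h. Qed.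

Lemma subspaceB (V : lmodType R[i]) (F : set V) u v :
  is_subspace F -> F u -> F v -> F (u - v).
Proof. by move=> sF Fu Fv; rewrite -scaleN1r; apply: subspaceD => //; exact: subspaceZ. Qed.

Lemma norm_cmul_le1 a b : `|a| <= 1 -> `|b| <= 1 -> `|a ** b| <= 1.
Proof. by move=> a1 b1; rewrite (le_trans (cnormM _ _))// mulr_ile1. Qed.

(* The square root is the limit of [1 - r_n] where [r_0 = 0] and
   [r_(n+1) = (1 - x + r_n ^ 2) / 2]; the scalar sequence for [x = 0] dominates
   the increments.  The constant terms of these polynomials in [x] tend to [0],
   which is why the limit lies in any closed subalgebra, unital or not. *)
Lemma exists_sqrt x : star x = x -> `|cone - x| <= 1 ->
  exists y, [/\ star y = y, y ** y = x, `|cone - y| <= 1,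
    forall c, c ** x = x ** c -> c ** y = y ** c &
    forall B, closed_subalgebra B -> B x -> B y].
Proof.
move=> sx x1; set z := cone - x; pose r := sqrt_iter z.
have z1 : `|z| <= 1 by [].
have rc : cvgn r.
  apply: (@cvgn_dominated r sqrt_bound).
    by apply/cvg_ex; exists 1; exact: sqrt_bound_cvg1.
  by move=> m n; exact: sqrt_iter_dist.
set l := limn r in rc *.
have r1 n : `|r n| <= 1.
  have /andP[_ h] := sqrt_bound_itv n.
  by rewrite (le_trans (norm_sqrt_iter _ _ z1))// -(rmorph1 (real_complex R)) lecR.
have l1 : `|l| <= 1.
  apply/ler_addgt0Pr => e e0.
  have /cvgrPdist_lt/(_ _ e0)[N _ /(_ _ (leqnn N))/= /ltW h] := rc.
  by rewrite -(subrK (r N) l) addrC (le_trans (ler_normD _ _))// lerD.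
have lE : l = 2^-1 *: (z + l ** l).
  apply/eqP; rewrite -subr_eq0 -normr_eq0; apply/eqP/le_anti.
  rewrite normr_ge0 andbT; apply/ler_addgt0Pr => e e0; rewrite add0r.
  have e20 : 0 < e / 2 by rewrite divr_gt0.
  have /cvgrPdist_lt/(_ _ e20)[N _ hN] := rc.
  have /ltW a1 := hN N (leqnn N); have /ltW a2 := hN N.+1 (leqnSn N).
  have -> : l - 2^-1 *: (z + l ** l) =
      (l - r N.+1) - 2^-1 *: (l ** (l - r N) + (l - r N) ** r N).
    have -> : r N.+1 = 2^-1 *: (z + r N ** r N) by [].
    rewrite cmulBr cmulBl addrA subrK -[RHS]addrA -opprD -scalerDr.
    by congr (_ - _ *: _); rewrite addrACA subrr addr0.
  rewrite [e](splitr e) (le_trans (ler_normB _ _))// lerD//.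
  rewrite normrZ normfV normr_nat ler_pdivrMl ?ltr0n//.
  rewrite mulrDl mul1r (le_trans (ler_normD _ _))// lerD//.
    by rewrite (le_trans (cnormM _ _))// (le_trans _ a1)// ler_piMl.
  by rewrite (le_trans (cnormM _ _))// (le_trans _ a1)// ler_piMr.
have lz : l + l = z + l ** l.
  by rewrite -mulr2n -scaler_nat {1}lE scalerA divff ?scale1r// pnatr_eq0.
exists (cone - l); split.
- rewrite starB star_cone; congr (_ - _); apply/eqP; rewrite -subr_eq0; apply/eqP.
  apply: (@lipschitz_cvg_zero (fun v => star v - v) 2 r l) => // [u v|n].
    rewrite opprD opprK addrACA -starB (le_trans (ler_normD _ _))// norm_star.
    by rewrite mulr_natl mulr2n lerD// addrC distrC.
  apply/eqP; rewrite subr_eq0; apply/eqP; elim: n => [|n IH]; first exact: star0.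
  rewrite [r n.+1]/(2^-1 *: (z + r n ** r n)) starZ starD starM IH starB.
  by rewrite star_cone sx fmorphV rmorph_nat.
- rewrite cmulBl cmul1l cmulBr cmul1r opprB addrACA -opprD lz.
  by rewrite opprD addrACA subrr addr0 opprB addrCA subrr addr0.
- by rewrite opprB addrCA subrr addr0.
- move=> c cx; have cz : c ** z = z ** c by rewrite cmulBl cmulBr cmul1l cmul1r cx.
  rewrite cmulBl cmulBr cmul1l cmul1r; congr (_ - _); apply/eqP.
  rewrite -subr_eq0; apply/eqP.
  apply: (@lipschitz_cvg_zero (fun v => c ** v - v ** c) (2 * `|c|) r l) => //.
  - move=> u v; have -> : c ** u - u ** c - (c ** v - v ** c) =
        c ** (u - v) - (u - v) ** c.
      rewrite cmulBl cmulBr !opprB [v ** c - _]addrC addrACA.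
      by rewrite [- (u ** c) + _]addrC.
    rewrite (le_trans (ler_normB _ _))// -mulrA mulr_natl mulr2n.
    by rewrite lerD ?cnormM// mulrC cnormM.
  - move=> n; apply/eqP; rewrite subr_eq0; apply/eqP.
    elim: n => [|n IH]; first by rewrite cmul0l cmul0r.
    rewrite [r n.+1]/(2^-1 *: (z + r n ** r n)) cmulZl cmulZr cmulDl cmulDr cz.
    by rewrite cmulA IH -cmulA IH cmulA.
- move=> B [sB cB mB] Bx.
  (* [sqrt_bound n] is the value of [r n] at [x = 0], so [b n] is, up to sign, the polynomial [r n]
     in [x] without its constant term. It tends to [cone - l] because [sqrt_bound] tends to [1]. *)
  pose b n := (sqrt_bound n)%:C *: cone - r n.
  apply: (@closed_cvgn B b) => //.
    apply/cvgrPdist_lt => e e0.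
    have er : e / 2 = (reC (e / 2))%:C by rewrite RRe_real// gtr0_real// divr_gt0.
    have e20 : 0 < e / 2 by rewrite divr_gt0.
    have e2r : 0 < reC (e / 2) by rewrite -ltcR -er.
    have /cvgrPdist_lt/(_ _ e20) h1 := rc.
    have /cvgrPdist_lt/(_ _ e2r) h2 := sqrt_bound_cvg1.
    near=> n.
    have -> : cone - l - b n = (1 - sqrt_bound n)%:C *: cone - (l - r n).
      rewrite rmorphB scalerBl rmorph1 scale1r /b !opprB addrACA [RHS]addrACA.
      by rewrite [- l + _]addrC.
    rewrite [e]splitr (le_lt_trans (ler_normB _ _))//.
    apply: ltrD; last by near: n.
    rewrite normrZ (le_lt_trans (ler_piMr _ norm_cone))//.
    rewrite normc_def /= expr0n addr0 sqrtr_sqr er ltcR.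
    by near: n.
  elim=> [|n IH].
    by rewrite /b /= scale0r subrr; exact: sB.1.
  have rb : r n = (sqrt_bound n)%:C *: cone - b n by rewrite opprB addrC subrK.
  have -> : b n.+1 = 2^-1 *: (x + (2 * (sqrt_bound n)%:C) *: b n - b n ** b n).
    have hs (t : R) : ((1 + t ^+ 2) / 2)%:C = 2^-1 * (1 + t%:C * t%:C).
      by rewrite rmorphM rmorphD rmorph1 fmorphV rmorph_nat rmorphXn mulrC expr2.
    have -> : b n.+1 = (sqrt_bound n.+1)%:C *: cone - 2^-1 *: (z + r n ** r n) by [].
    rewrite rb [sqrt_bound n.+1]/= hs -(scalerA 2^-1 (1 + _)) -scalerBr.
    congr (_ *: _).
    move: (b n) (sqrt_bound n)%:C => v t.
    rewrite cmulBl !cmulBr !cmulZl !cmulZr !cmul1l !cmul1r /z scalerDl scale1r scalerA.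
    rewrite -(scalerA 2 t) scaler_nat mulr2n.
    move: ((t * t) *: cone) (t *: v) (v ** v) => s w q.
    rewrite opprD !opprB addrACA (addrCA cone) subrr addr0.
    rewrite [w - q + _]addrACA -opprD addrCA [s + _]addrC.
    by rewrite opprD -!addrA addNr addr0.
  apply: subspaceZ => //; apply: subspaceB => //; last exact: (mB _ _ IH IH).
  by apply: subspaceD => //; exact: subspaceZ.
Unshelve. all: by end_near.
Qed.
End SquareRoots.

(** * Positive elements and membership of square roots in subalgebras *)

Section PositiveElements.
Context {R : realType} {A : cstarAlgType R}.
Implicit Types (a b c g j p q x y : A) (B : set A).

Lemma starZ_real (t : R[i]) a : t \is Num.real -> star (t *: a) = t *: star a.
Proof. by move=> /RRe_real <-; rewrite starZ; congr (_ *: _); exact: conjc_real. Qed.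

Lemma comm_inv v x c : v ** x = cone -> x ** v = cone ->
  c ** x = x ** c -> c ** v = v ** c.
Proof.
move=> vx xv cx; rewrite -[c in LHS]cmul1l -vx -(cmulA v) -cx cmulA -cmulA xv.
by rewrite cmul1r.
Qed.

Lemma star_inv v x : v ** x = cone -> x ** v = cone -> star x = x -> star v = v.
Proof.
move=> vx xv sx; rewrite -[LHS]cmul1l -vx -cmulA -{1}sx -starM vx star_cone.
by rewrite cmul1r.
Qed.

(* Otherwise [h = (1 - p) / `|1 - p|] has norm 1, [h = j ^ 2] and [1 - h = l ^ 2]
   is invertible, with inverse [v] say.  For small [d > 0] there is [y] with
   [y ^ 2 = 1 - d v], whence [(l y) ^ 2 + j ^ 2 = 1 - d] and
   [`|h| = `|j| ^ 2 <= 1 - d]. *)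
Lemma norm_cone_sub_le1 p : star p = p -> `|p| <= 1 ->
  (forall t : R, 0 < t -> exists v,
     v ** (p + t%:C *: cone) = cone /\ (p + t%:C *: cone) ** v = cone) ->
  `|cone - p| <= 1.
Proof.
move=> sp p1 pinv; rewrite real_leNgt ?ger0_real//; apply/negP.
set m := `|cone - p| => m1.
have m0 : 0 < m by rewrite (lt_trans ltr01).
have mr : m \is Num.real by rewrite gtr0_real.
have mVr : m^-1 \is Num.real by rewrite realV.
pose h := m^-1 *: (cone - p); pose k := cone - h.
have h1 : `|h| = 1.
  by rewrite normrZ normfV (gtr0_norm m0) mulVf// gt_eqF.
(* This displays [k] as a positive multiple of [p + t] with [t = m - 1 > 0], which is invertible by
   hypothesis. *)
have kE : k = m^-1 *: (p + (m - 1) *: cone).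
  rewrite /k /h -[cone in cone - _](scalerK (negbT (gt_eqF m0))) -scalerBr.
  by congr (_ *: _); rewrite opprB addrCA scalerBl scale1r.
have sh : star h = h by rewrite starZ_real// starB star_cone sp.
have sk : star k = k by rewrite starB star_cone sh.
have k1 : `|cone - h| <= 1.
  rewrite -/k kE normrZ normfV (gtr0_norm m0) ler_pdivrMl// mulr1.
  rewrite (le_trans (ler_normD _ _))// -[leRHS](subrKC 1) lerD//.
  by rewrite normrZ ger0_norm ?ler_piMr ?norm_cone// subr_ge0 ltW.
have [v [vk kv]] : exists v, v ** k = cone /\ k ** v = cone.
  have [|w [w1 w2]] := pinv (reC m - 1).
    by rewrite subr_gt0 -ltcR RRe_real.
  have e : (reC m - 1)%:C = m - 1 by rewrite rmorphB /= RRe_real.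
  exists (m *: w); move: w1 w2; rewrite e kE => w1 w2.
  by split; rewrite cmulZl cmulZr scalerA ?w1 ?w2 ?mulVf ?mulfV ?scale1r// gt_eqF.
have sv := star_inv _ _ vk kv sk.
(* The choice keeps the norm of [d *: v] at most [1], so that [cone - d *: v] has a square root. *)
pose d := (1 + `|v|)^-1.
have d0 : 0 < d by rewrite invr_gt0 ltr_pwDl.
have d1 : d <= 1 by rewrite invf_le1 ?lerDl// ltr_pwDl.
have [j [sj jj _ cj _]] := exists_sqrt h sh k1.
have [|l [sl ll _ cl _]] := exists_sqrt k sk.
  by rewrite /k opprB addrCA subrr addr0 h1.
pose x := cone - d *: v.
have sx : star x = x by rewrite starB star_cone starZ_real ?sv// gtr0_real.
have x1 : `|cone - x| <= 1.
  rewrite /x opprB addrCA subrr addr0 normrZ gtr0_norm//.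
  by rewrite mulrC ler_pdivrMr ?mul1r ?lerDr// ltr_pwDl.
have [y [sy yy _ cy _]] := exists_sqrt x sx x1.
(* [y] commutes with all that commutes with [k], as the inverse [v] does; hence [l], [y] and [j]
   commute pairwise. *)
have commk c : c ** k = k ** c -> c ** y = y ** c.
  move=> ck; apply: cy; rewrite cmulBl cmulBr cmul1l cmul1r cmulZl cmulZr.
  by rewrite (comm_inv _ _ _ vk kv ck).
have jk : j ** k = k ** j.
  by rewrite cmulBl cmulBr cmul1l cmul1r -jj cmulA.
have lk : l ** k = k ** l by rewrite -ll cmulA.
have ly := commk _ lk; have jy := commk _ jk; have jl := cl _ jk.
have sg : star (l ** y) = l ** y by rewrite starM sl sy ly.
have gj : (l ** y) ** j = j ** (l ** y).
  by rewrite -cmulA -jy cmulA -jl cmulA.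
have := norm_sqr_le_add _ _ sg sj gj.
have -> : (l ** y) ** (l ** y) + j ** j = (1 - d) *: cone.
  rewrite {1}ly cmulA -(cmulA y) ll -(commk k erefl) -cmulA yy.
  rewrite cmulBr cmul1r cmulZr kv jj {1}/k addrAC subrK.
  by rewrite scalerBl scale1r.
rewrite -norm_sqr_sa// jj h1 normrZ ger0_norm ?subr_ge0//.
apply/negP; rewrite -real_ltNge ?ger0_real// ?mulr_ge0 ?subr_ge0//.
rewrite (le_lt_trans (ler_piMr _ norm_cone)) ?subr_ge0//.
by rewrite gtrDl oppr_lt0.
Qed.

(* [p] and the square root [q] of [p ^ 2] satisfy [(p - q) (p + q) = 0]; with
   [p = b ^ 2] and [q = c ^ 2] this is a sum of two squares. *)
Lemma mem_of_sqr (B : set A) p : closed_subalgebra B -> star p = p -> `|p| <= 1 ->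
  `|cone - p| <= 1 -> B (p ** p) -> B p.
Proof.
move=> BB sp p1 cp1 Bpp.
have spp : star (p ** p) = p ** p by rewrite starM sp.
(* [1 - p ^ 2] is a square [s ^ 2] with [s] commuting with [p], so its norm is at most that of
   [p ^ 2 + s ^ 2 = 1]. *)
have cpp1 : `|cone - p ** p| <= 1.
  have [||s [ss s2 _ cs _]] := exists_sqrt (cone - p ** p).
  - by rewrite starB star_cone spp.
  - by rewrite opprB addrCA subrr addr0 norm_cmul_le1.
  rewrite -s2 norm_sqr_sa// (le_trans (norm_sqr_le_add p s _ _ _))//.
    by apply: cs; rewrite cmulBl cmulBr cmul1l cmul1r cmulA.
  by rewrite s2 addrC subrK norm_cone.
have [q [sq qq q1 cq Bq]] := exists_sqrt _ spp cpp1.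
have pq : p ** q = q ** p by apply: cq; rewrite cmulA.
have [b [sb bb _ cb _]] := exists_sqrt _ sp cp1.
have [c [sc cc _ cc' _]] := exists_sqrt _ sq q1.
have qb : q ** b = b ** q by exact: cb.
have bc : b ** c = c ** b by exact: cc'.
have pc : p ** c = c ** p by exact: cc'.
have pb : p ** b = b ** p by exact: cb.
have qc : q ** c = c ** q by exact: cc'.
suff /eqP : p - q = 0 by rewrite subr_eq0 => /eqP ->; exact: Bq.
set d := p - q.
have db : d ** b = b ** d by rewrite cmulBl cmulBr pb qb.
have dc : d ** c = c ** d by rewrite cmulBl cmulBr pc qc.
have sd : star d = d by rewrite starB sp sq.
(* The sum is [d ** d ** (p + q)], and [d ** (p + q) = p ^ 2 - q ^ 2 = 0]. *)
have sum0 : (d ** b) ** (d ** b) + (d ** c) ** (d ** c) = 0.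
  rewrite {2}db {2}dc !cmulA -(cmulA d b b) -(cmulA d c c) bb cc -!cmulA -cmulDr.
  rewrite -cmulDl cmulBr !cmulDl pq qq [_ + p ** p]addrC subrr.
  by rewrite !cmul0r addr0.
have gj : (d ** b) ** (d ** c) = (d ** c) ** (d ** b).
  by rewrite -!cmulA (cmulA b) -db (cmulA c) -dc -!cmulA bc.
have sdb : star (d ** b) = d ** b by rewrite starM sd sb db.
have sdc : star (d ** c) = d ** c by rewrite starM sd sc dc.
have dc0 : d ** c = 0.
  apply/eqP; rewrite -normr_eq0 -sqrf_eq0 eq_le exprn_ge0// andbT.
  by rewrite (le_trans (norm_sqr_le_add _ _ sdb sdc gj))// sum0 normr0.
have db0 : d ** b = 0.
  apply/eqP; rewrite -normr_eq0 -sqrf_eq0 eq_le exprn_ge0// andbT.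
  by rewrite (le_trans (norm_sqr_le_add _ _ sdc sdb _))// addrC sum0 normr0.
apply/eqP; rewrite -normr_eq0 -sqrf_eq0 -norm_sqr_sa// {2}/d cmulBr -bb -cc.
by rewrite !cmulA db0 dc0 !cmul0l subrr normr0.
Qed.
End PositiveElements.

(** * Closed spans and square roots of positive elements *)

Section Subalgebra.
Context {R : realType} {A : cstarAlgType R}.
Implicit Types (a b p x y : A) (B : set A).

Lemma lipschitz_continuous (f : A -> A) (K : R[i]) : 0 <= K ->
  (forall x y, `|f x - f y| <= K * `|x - y|) -> continuous f.
Proof.
move=> K0 fK x; apply/cvgrPdist_lt => e e0.
have eK : 0 < e / (K + 1) by rewrite divr_gt0// ltr_wpDl.
near=> y.
have /ltW xy : `|x - y| < e / (K + 1).
  by near: y; apply: (@cvgr_dist_lt _ _ _ _ _ id) => //; exact: cvg_id.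
rewrite (le_lt_trans (fK _ _))// (le_lt_trans (ler_wpM2l K0 xy))//.
by rewrite mulrCA gtr_pMr// ltr_pdivrMr ?mul1r ?ltrDl// ltr_wpDl.
Unshelve. all: by end_near. Qed.

Lemma closure_sub_closed (T : topologicalType) (S C : set T) :
  closed C -> S `<=` C -> closure S `<=` C.
Proof. by move=> cC SC; rewrite closureE; apply: smallest_sub. Qed.

Lemma closed_preimage_lipschitz B (f : A -> A) (K : R[i]) : closed B -> 0 <= K ->
  (forall x y, `|f x - f y| <= K * `|x - y|) -> closed [set x | B (f x)].
Proof.
move=> cB K0 fK; apply: (@preimage_closed _ _ f B) => // x _.
exact: lipschitz_continuous fK x.
Qed.

Lemma subspace_smallest (S : set A) :
  is_subspace (smallest (@is_subspace R[i] A) S).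
Proof.
split=> [M [[]]//|c x y Sx Sy M hM]; have [[_ h] _] := hM.
by apply: h; [exact: Sx|exact: Sy].
Qed.

Lemma subspace_closure (S : set A) : is_subspace S -> is_subspace (closure S).
Proof.
move=> [S0 Slin]; split; first exact: subset_closure.
(* Linearity passes to the closure one variable at a time; here the second one is still in [S]. *)
have SclS c y : S y -> closure S `<=` [set x | closure S (c *: x + y)].
  move=> Sy; apply: closure_sub_closed.
    apply: (@closed_preimage_lipschitz _ _ `|c|) => //; first exact: closed_closure.
    by move=> u v; rewrite opprD addrACA subrr addr0 -scalerBr normrZ.
  by move=> x Sx; apply: subset_closure; exact: Slin.
move=> c x y Cx Cy.
apply: (@closure_sub_closed _ S [set z | closure S (c *: x + z)] _ _ y Cy); last first.
  by move=> z Sz; exact: SclS.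
apply: (@closed_preimage_lipschitz _ _ 1) => //; first exact: closed_closure.
by move=> u v; rewrite opprD addrACA subrr add0r mul1r.
Qed.

Lemma subspace_closed_span (S : set A) : is_subspace (closed_span S).
Proof. exact: subspace_closure (subspace_smallest S). Qed.

Lemma closed_span_min (S C : set A) : is_subspace C -> closed C -> S `<=` C ->
  closed_span S `<=` C.
Proof. by move=> sC cC SC; apply: closure_sub_closed => //; exact: smallest_sub. Qed.

Lemma sub_closed_span (S : set A) : S `<=` closed_span S.
Proof. by move=> x Sx; apply: subset_closure => M [_]; exact. Qed.

(** After division by one plus its norm, [p] falls under [mem_of_sqr]. Invertibility of [p + t] for
    [t > 0] says that [- t] is not in the spectrum. *)
Lemma mem_positive_sqrt B p : closed_subalgebra B -> positive_elt p ->
  B (p ** p) -> B p.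
Proof.
move=> BB [sp pp] Bpp; have [sB cB mB] := BB.
pose c := 1 + `|p|; have c0 : 0 < c by rewrite ltr_pwDl.
have cr : c^-1 \is Num.real by rewrite realV gtr0_real.
rewrite -[p](scalerKV (negbT (gt_eqF c0))); apply: subspaceZ => //.
apply: mem_of_sqr => //.
- by rewrite starZ_real// sp.
- rewrite normrZ normfV gtr0_norm// ler_pdivrMl// mulr1 lerDr//.
- apply: norm_cone_sub_le1.
  + by rewrite starZ_real// sp.
  + by rewrite normrZ normfV gtr0_norm// ler_pdivrMl// mulr1 lerDr//.
  + move=> t t0; pose s := c * t%:C.
    have s0 : 0 < s by rewrite mulr_gt0// ltcR.
    have [b [b1 b2]] : exists b, b ** (p - (- s) *: cone) = cone /\
        (p - (- s) *: cone) ** b = cone.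
      apply: contrapT => nb; have := pp _ nb.
      by rewrite oppr_ge0 (lt_geF s0).
    have pE : c^-1 *: p + t%:C *: cone = c^-1 *: (p - (- s) *: cone).
      by rewrite scaleNr opprK scalerDr scalerA mulKf// gt_eqF.
    exists (c *: b); rewrite pE; split.
      by rewrite cmulZl cmulZr b1 scalerKV// gt_eqF.
    by rewrite cmulZl cmulZr b2 scalerK// gt_eqF.
- by rewrite cmulZl cmulZr scalerA; exact: subspaceZ.
Qed.

End Subalgebra.

(** * The algebra of inner products and its absolute values *)

Section Abs.
Context {R : realType} {A : cstarAlgType R} {E : hilbertModType A}.
Variables (F : set E) (hF : ternary F).

(** The product [inner u v ** b] is [inner u (ract v b)], and ternarity keeps [ract v b] in [F];
    linearity and closedness extend this to every left factor. *)
Lemma inner_span_subalgebra : closed_subalgebra (inner_span F).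
Proof.
have [sF cF mF] := hF.
split; [exact: subspace_closed_span|exact: closed_closure|].
move=> a b aB bB; apply: (@closed_span_min _ _ _ [set z | inner_span F (z ** b)] _ _ _ a aB).
- split=> /=; first by rewrite cmul0l; exact: (subspace_closed_span _).1.
  move=> c u v Bu Bv; rewrite cmulDl cmulZl.
  exact: (subspace_closed_span _).2.
- apply: (@closed_preimage_lipschitz _ _ _ _ `|b|) => //; first exact: closed_closure.
  by move=> u v; rewrite -cmulBl mulrC cnormM.
- move=> _ [[u v] [/= Fu Fv] <-]; rewrite -inner_ract; apply: sub_closed_span.
  by exists (u, ract v b) => //; split => //=; exact: mF.
Qed.

Lemma module_abs_sqr_mem x : F x ->
  inner_span F (module_abs x ** module_abs x) /\ inner_span F (module_abs x).
Proof.
move=> Fx; have BB := inner_span_subalgebra; have [sB _ _] := BB.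
(* [xget] returns either a positive root [p] of [inner x x] or the default [0]; both cases land in
   the span. *)
rewrite /module_abs /cstar_sqrt; case: xgetP => [p _ [pp ppx]|_].
  have Bpp : inner_span F (p ** p).
    by rewrite ppx; apply: sub_closed_span; exists (x, x).
  by split=> //; exact: (mem_positive_sqrt _ _ BB pp Bpp).
by rewrite cmul0l; split; case: sB.
Qed.

Lemma star_module_abs (x : E) : star (module_abs x) = module_abs x.
Proof.
rewrite /module_abs /cstar_sqrt; case: xgetP => [p _ [[]//]|_]; exact: star0.
Qed.

End Abs.

(** * Compact sets of real functions *)

Section Pointwise.
Context {R : realType} {I : choiceType}.
Local Notation X := (prod_topology (fun _ : I => R)).
Implicit Types (f g h : X) (Q S C : set X).

Lemma eval_continuous (i : I) : continuous (fun f : X => f i).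
Proof. exact: (@proj_continuous I (fun _ => R) i). Qed.

Definition extreme_in Q f := Q f /\ forall g h (t : R), Q g -> Q h -> 0 < t < 1 ->
  (forall i, f i = t * g i + (1 - t) * h i) -> g = f /\ h = f.

Lemma open_eval_lt (i : I) (m : R) : open [set f : X | f i < m].
Proof.
apply: (@open_comp _ _ (fun f : X => f i) [set y | y < m]) => [f _|].
  exact: eval_continuous.
exact: open_lt.
Qed.

Lemma compact_max_eval Q (i : I) : Q !=set0 -> compact Q ->
  exists2 f, Q f & forall g, Q g -> g i <= f i.
Proof.
move=> Q0 cQ.
have [|f fQ fmax] := @compact_EVT_max X R (fun f : X => f i) Q Q0 cQ.
  by apply: continuous_subspaceT => f; exact: eval_continuous.
by exists f => [|g Qg]; [exact: set_mem|apply: fmax; exact: mem_set].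
Qed.

Lemma pointwise_hausdorff : hausdorff_space X.
Proof. by apply: hausdorff_product => i; exact: Rhausdorff. Qed.

Definition face Q S := S !=set0 /\
  forall f g h (t : R), S f -> Q g -> Q h -> 0 < t < 1 ->
    (forall i, f i = t * g i + (1 - t) * h i) -> S g /\ S h.

Lemma convex_eq_max (x y m t : R) : 0 < t < 1 -> x <= m -> y <= m ->
  m = t * x + (1 - t) * y -> x = m /\ y = m.
Proof. by move=> /andP[t0 t1] xm ym e; split; nra. Qed.

(** Zorn's lemma yields a minimal closed face. Each coordinate is constant on it, since the points
    where a coordinate is maximal form a closed face again; so it is a single point, which is
    extreme. *)
Lemma compact_extreme Q : Q !=set0 -> compact Q -> exists f, extreme_in Q f.
Proof.
move=> Q0 cQ.
have clQ : closed Q by exact: compact_closed pointwise_hausdorff cQ.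
(* Faces are handled through open complements: a minimal face is a maximal [C], and a chain is
   bounded by its union. *)
pose P : set (set X) := [set C | open C /\ face Q (Q `\` C)].
have [F FP Ftot|C [[oC [SC0 faceC]] maxC]] := @Zorn_bigcup X P.
  split; first by apply: bigcup_open => C /FP[].
  split; last first.
    move=> f g h t [Qf Ff] Qg Qh t01 e.
    have H C : F C -> (Q `\` C) g /\ (Q `\` C) h.
      move=> FC; have [_ [_ fC]] := FP _ FC.
      by apply: (fC f g h t) => //; split => // Cf; apply: Ff; exists C.
    by split; split=> // -[C FC]; have [[_ ?] [_ ?]] := H _ FC.
  have [F0|/set0P/negP/negPn/eqP->] := pselect (F !=set0); last first.
    by rewrite bigcup_set0 setD0.
  (* A cluster point of the faces avoids every open [C] of the chain, so the intersection of the
     faces is nonempty. *)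
  pose G := filter_from F (fun C => Q `\` C).
  have GF : ProperFilter G.
    apply: filter_from_proper => [|C /FP[_ []//]].
    apply: filter_from_filter => // C D FC FD.
    have [CD|DC] := Ftot _ _ FC FD.
      by exists D => // f [Qf Df]; split; split=> // /CD.
    by exists C => // f [Qf Df]; split; split=> // /DC.
  have [|p [Qp Gp]] := cQ G GF.
    by have [C FC] := F0; exists C => // f [].
  exists p; split=> // -[C FC Cp].
  have oC := (FP _ FC).1.
  have GC : G (Q `\` C) by exists C.
  have Cp' : nbhs p C by apply: open_nbhs_nbhs; split.
  by have [q [[_ ?] //]] := Gp _ _ GC Cp'.
have const i : exists m, forall f, (Q `\` C) f -> f i = m.
  have cS : compact (Q `\` C).
    apply: (subclosed_compact _ cQ) => [|f []//].
    by rewrite setDE; apply: closedI => //; exact: open_closedC.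
  have [f0 Sf0 fmax] := compact_max_eval _ i SC0 cS.
  exists (f0 i) => f Sf; apply/eqP; rewrite eq_le fmax//= leNgt; apply/negP => flt.
  (* If some [f] in the face lay below the maximum [f0 i], discarding all such points would leave a
     smaller face. *)
  pose C' := C `|` [set f | f i < f0 i].
  apply: (maxC C').
    split; first by move=> g Cg; left.
    by move=> C'C; apply: Sf.2; apply: C'C; right.
  split; first by apply: openU => //; exact: open_eval_lt.
  split.
    by exists f0; split; [exact: Sf0.1|move=> [/Sf0.2//|/=]]; rewrite ltxx.
  move=> g h k t [Qg /not_orP[Cg gm]] Qh Qk t01 e.
  have [Sh Sk] := faceC g h k t (conj Qg Cg) Qh Qk t01 e.
  have gE : f0 i = t * h i + (1 - t) * k i.
    rewrite -e; apply/eqP; rewrite eq_le fmax// andbT leNgt; exact/negP.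
  have [hE kE] := convex_eq_max _ _ _ _ t01 (fmax _ Sh) (fmax _ Sk) gE.
  by split; split=> // -[];
    [exact: Sh.2|rewrite /= hE ltxx|exact: Sk.2|rewrite /= kE ltxx].
have [f Sf] := SC0; exists f; split; first exact: Sf.1.
move=> g h t Qg Qh t01 e.
have [Sg Sh] := faceC f g h t Sf Qg Qh t01 e.
by split; apply/funext => i; have [m hm] := const i; rewrite !hm.
Qed.

(** The slice of [Q] where the coordinate [i0] is maximal is compact and extreme in [Q], so its
    extreme points are extreme in [Q]. *)
Lemma compact_extreme_max Q (i0 : I) : Q !=set0 -> compact Q ->
  exists2 f, extreme_in Q f & forall g, Q g -> g i0 <= f i0.
Proof.
move=> Q0 cQ; have [f0 Qf0 fmax] := compact_max_eval _ i0 Q0 cQ.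
have [||f [[Qf fm] fext]] := compact_extreme (Q `&` [set f | f0 i0 <= f i0]).
- by exists f0; split => /=.
- apply: compact_closedI => //.
  apply: (@preimage_closed _ _ (fun f : X => f i0) [set y | f0 i0 <= y]).
    by move=> f _; exact: eval_continuous.
  exact: closed_ge.
exists f; last by move=> g Qg; exact: le_trans (fmax _ Qg) fm.
split=> // g h t Qg Qh t01 e.
have fE : f0 i0 = t * g i0 + (1 - t) * h i0.
  by rewrite -e; apply/eqP; rewrite eq_le fmax// andbT.
have [gE hE] := convex_eq_max _ _ _ _ t01 (fmax _ Qg) (fmax _ Qh) fE.
by apply: (fext g h t) => //; split => //=; rewrite ?gE ?hE.
Qed.

Definition convex_fun_set Q := forall f g (t : R), Q f -> Q g -> 0 <= t <= 1 ->
  Q ((fun i => (1 - t) * f i + t * g i) : X).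

Lemma sqdist_continuous (psi : X) (s : seq I) :
  continuous (fun f : X => \sum_(i <- s) (f i - psi i) ^+ 2).
Proof.
elim: s => [|i s IH].
  have -> : (fun f : X => \sum_(i <- [::]) (f i - psi i) ^+ 2) = cst 0.
    by apply/funext => f; rewrite big_nil.
  exact: cst_continuous.
have -> : (fun f : X => \sum_(j <- i :: s) (f j - psi j) ^+ 2) =
    (fun f : X => (f i - psi i) * (f i - psi i) + \sum_(j <- s) (f j - psi j) ^+ 2).
  by apply/funext => f; rewrite big_cons expr2.
have c1 : continuous (fun f : X => f i - psi i).
  move=> f; apply: (@continuousB _ _ _ (fun f : X => f i) (cst (psi i))).
    exact: eval_continuous.
  exact: cst_continuous.
move=> f.
apply: (@continuousD _ _ _ (fun f : X => (f i - psi i) * (f i - psi i)) _ f _ (IH f)).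
exact: (@continuousM _ _ _ _ f (c1 f) (c1 f)).
Qed.

(* At a point [f0] of [T] nearest to [psi] in finitely many coordinates, moving
   towards an element of [T] that is large in the direction [psi - f0] would
   decrease the distance. *)
Lemma compact_convex_agree_seq (T : set X) (psi : X) (s : seq I) :
  compact T -> convex_fun_set T ->
  (forall (c : I -> R) (e : R), 0 < e -> exists2 f, T f &
     \sum_(i <- s) c i * psi i - e <= \sum_(i <- s) c i * f i) ->
  exists2 f, T f & forall i, i \in s -> f i = psi i.
Proof.
move=> cT convT H.
have T0 : T !=set0 by have [f Tf _] := H (fun=> 0) 1 ltr01; exists f.
pose D (f : X) := \sum_(i <- s) (f i - psi i) ^+ 2.
have [|f0 /set_mem Tf0 fmin] := @compact_EVT_min X R D T T0 cT.
  by apply: continuous_subspaceT; exact: sqdist_continuous.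
have D0 f : 0 <= D f by apply: sumr_ge0 => i _; exact: sqr_ge0.
have [Df0|] := eqVneq (D f0) 0.
  exists f0 => // i si; apply/eqP; rewrite -subr_eq0 -sqrf_eq0.
  move/eqP: Df0; rewrite psumr_eq0 => [/allP/(_ _ si)//|j _]; exact: sqr_ge0.
rewrite neq_lt ltNge D0 /= => d0.
have [f Tf Hf] := H (fun i => psi i - f0 i) (D f0 / 2) (divr_gt0 d0 (ltr0n _ 2)).
pose K : R := \sum_(i <- s) (f i - f0 i) ^+ 2.
have K0 : 0 <= K by apply: sumr_ge0 => i _; exact: sqr_ge0.
(* For this [t], [t * K = D f0 - t * D f0] is below [D f0], while the accuracy [D f0 / 2] in [Hf]
   gives [2 * P >= D f0] for the inner product [P] below. So [D f0 - 2 * t * P + t ^+ 2 * K] drops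
   below the minimum. *)
pose t := D f0 / (D f0 + K).
have DK : 0 < D f0 + K by rewrite ltr_wpDr.
have t0 : 0 < t by rewrite divr_gt0.
have t1 : t <= 1 by rewrite ler_pdivrMr// mul1r lerDl.
have tE : t * (D f0 + K) = D f0 by rewrite divfK// gt_eqF.
have : D f0 <= D (fun i => (1 - t) * f0 i + t * f i).
  by apply: fmin; apply: mem_set; apply: convT; rewrite ?(ltW t0).
pose P : R := \sum_(i <- s) (psi i - f0 i) * (f i - f0 i).
have -> : D (fun i => (1 - t) * f0 i + t * f i) = D f0 - 2 * t * P + t ^+ 2 * K.
  rewrite /D /P /K !mulr_sumr -sumrB -big_split /=.
  by apply: eq_bigr => i _; ring.
have PE : P = \sum_(i <- s) (psi i - f0 i) * f i
    - \sum_(i <- s) (psi i - f0 i) * psi i + D f0.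
  by rewrite /P /D -sumrB -big_split /=; apply: eq_bigr => i _; ring.
have P2 : D f0 / 2 <= P by rewrite PE; lra.
have td : 0 < t * D f0 by rewrite mulr_gt0.
have -> : D f0 - 2 * t * P + t ^+ 2 * K = D f0 - t * (2 * P - t * K) by ring.
rewrite lerBrDl gerDr pmulr_rle0// => h.
move: P2 td h tE => {PE}; rewrite mulrDr => P2 td h tE; lra.
Qed.

(** The hypothesis says that no linear functional in finitely many coordinates from [J] separates
    [psi] from [T]. Each finite list of coordinates can then be matched, and compactness of [T]
    matches all of [J] at once. *)
Lemma compact_convex_agree (T : set X) (psi : X) (J : set I) :
  compact T -> convex_fun_set T ->
  (forall (s : seq I) (c : I -> R) (e : R), (forall i, i \in s -> J i) -> 0 < e ->
     exists2 f, T f & \sum_(i <- s) c i * psi i - e <= \sum_(i <- s) c i * f i) ->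
  exists2 f, T f & forall i, J i -> f i = psi i.
Proof.
move=> cT convT H.
pose D : set (seq I) := fun s => forall i : I, i \in s -> J i.
pose V (s : seq I) : set X := [set f | T f /\ forall i, i \in s -> f i = psi i].
pose G := filter_from D V.
have GF : ProperFilter G.
  apply: filter_from_proper => [|s Ds]; last first.
    have [|f Tf fE] := compact_convex_agree_seq T psi s cT convT.
      by move=> c e e0; exact: H.
    by exists f.
  apply: filter_from_filter; first by exists [::].
  move=> s s' Ds Ds'; exists (s ++ s').
    by move=> i; rewrite mem_cat => /orP[/Ds|/Ds'].
  by move=> f [Tf fE]; split; split=> // i si; apply: fE; rewrite mem_cat si ?orbT.
have [|p [Tp Gp]] := cT G GF; first by exists [::] => // f [].
exists p => // i Ji.
have cl : closed [set f : X | f i = psi i].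
  apply: (@preimage_closed _ _ (fun f : X => f i) [set y | y = psi i]).
    by move=> f _; exact: eval_continuous.
  exact: closed_eq.
apply: cl => U pU; apply: Gp => //; exists [:: i].
  by move=> k; rewrite inE => /eqP ->.
by move=> f [_ /(_ i)]; rewrite mem_head => /(_ erefl).
Qed.

End Pointwise.

(** * Closed conditions on complex-valued functions *)

Section ComplexContinuity.
Context {R : realType} {Y : topologicalType}.
Implicit Types F G : Y -> R[i].

(** For an encoded functional these two parts are coordinates of the pointwise topology. *)
Definition ccont F :=
  continuous (fun y => reC (F y)) /\ continuous (fun y => imC (F y)).

Lemma ccont_cst (c : R[i]) : ccont (fun=> c).
Proof. by split; exact: cst_continuous. Qed.

Lemma ccont_real (u : Y -> R) : continuous u -> ccont (fun y => (u y)%:C).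
Proof. by split=> //; exact: cst_continuous. Qed.

Lemma ccontD F G : ccont F -> ccont G -> ccont (fun y => F y + G y).
Proof.
move=> [rF iF] [rG iG]; split.
  have -> : (fun y => reC (F y + G y)) = (fun y => reC (F y) + reC (G y)).
    by apply/funext => y; case: (F y) => ? ?; case: (G y).
  by move=> y; exact: (@continuousD _ _ _ _ _ _ (rF y) (rG y)).
have -> : (fun y => imC (F y + G y)) = (fun y => imC (F y) + imC (G y)).
  by apply/funext => y; case: (F y) => ? ?; case: (G y).
by move=> y; exact: (@continuousD _ _ _ _ _ _ (iF y) (iG y)).
Qed.

Lemma ccontM F G : ccont F -> ccont G -> ccont (fun y => F y * G y).
Proof.
move=> [rF iF] [rG iG]; split.
  have -> : (fun y => reC (F y * G y)) =
      (fun y => reC (F y) * reC (G y) - imC (F y) * imC (G y)).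
    by apply/funext => y; case: (F y) => ? ?; case: (G y).
  move=> y; exact: (@continuousB _ _ _ _ _ _ (@continuousM _ _ _ _ _ (rF y) (rG y))
    (@continuousM _ _ _ _ _ (iF y) (iG y))).
have -> : (fun y => imC (F y * G y)) =
    (fun y => reC (F y) * imC (G y) + imC (F y) * reC (G y)).
  by apply/funext => y; case: (F y) => ? ?; case: (G y).
move=> y; exact: (@continuousD _ _ _ _ _ _ (@continuousM _ _ _ _ _ (rF y) (iG y))
  (@continuousM _ _ _ _ _ (iF y) (rG y))).
Qed.

Lemma ccontJ F : ccont F -> ccont (fun y => conjc (F y)).
Proof.
move=> [rF iF]; split.
  have -> : (fun y => reC (conjc (F y))) = (fun y => reC (F y)).
    by apply/funext => y; case: (F y).
  exact: rF.
have -> : (fun y => imC (conjc (F y))) = (fun y => - imC (F y)).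
  by apply/funext => y; case: (F y).
by move=> y; exact: (@continuousN _ _ _ _ _ (iF y)).
Qed.

Lemma closed_le_cont (u v : Y -> R) : continuous u -> continuous v ->
  closed [set y | u y <= v y].
Proof.
move=> cu cv.
have -> : [set y | u y <= v y] = (fun y => v y - u y) @^-1` [set r | 0 <= r].
  by apply/seteqP; split => y /=; rewrite subr_ge0.
apply: (@preimage_closed _ _ (fun y => v y - u y)); last exact: closed_ge.
by move=> y _; exact: (@continuousB _ _ _ _ _ _ (cv y) (cu y)).
Qed.

Lemma closed_le_ccont F G : ccont F -> ccont G -> closed [set y | F y <= G y].
Proof.
move=> [rF iF] [rG iG].
have -> : [set y | F y <= G y] =
    [set y | imC (F y) <= imC (G y)] `&` [set y | imC (G y) <= imC (F y)]
    `&` [set y | reC (F y) <= reC (G y)].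
  apply/seteqP; split => y /=; rewrite lecE.
    by case/andP => /eqP -> ->.
  by move=> [[a b] c]; rewrite c andbT eq_le a b.
by apply: closedI; [apply: closedI|]; exact: closed_le_cont.
Qed.

Lemma closed_eq_ccont F G : ccont F -> ccont G -> closed [set y | F y = G y].
Proof.
move=> cF cG.
have -> : [set y | F y = G y] = [set y | F y <= G y] `&` [set y | G y <= F y].
  apply/seteqP; split => y /=; first by move=> ->.
  by move=> [a b]; apply/le_anti/andP.
by apply: closedI; exact: closed_le_ccont.
Qed.

Lemma closed_forall (J : Type) (P : J -> Prop) (S : J -> set Y) :
  (forall j, P j -> closed (S j)) -> closed [set y | forall j, P j -> S j y].
Proof.
move=> cS.
have -> : [set y | forall j, P j -> S j y] = \bigcap_(j in [set j | P j]) S j.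
  by apply/seteqP; split.
exact: closed_bigI.
Qed.

End ComplexContinuity.

(** * States and pure states *)

Section Functionals.
Context {R : realType} {A : cstarAlgType R}.
Implicit Types (a b : A) (B : set A) (phi psi : A -> R[i]).
Local Notation X := (prod_topology (fun _ : bool * A => R)).

(* Functionals are encoded by their real and imaginary parts, so that the library's
   pointwise topology on real-valued functions applies. *)
Definition fun_of (f : X) (a : A) : R[i] := f (true, a) +i* f (false, a).

Definition coords phi : X := fun i => if i.1 then reC (phi i.2) else imC (phi i.2).

Lemma coordsK phi : fun_of (coords phi) = phi.
Proof. by apply/funext => a; rewrite /fun_of /coords /=; case: (phi a). Qed.

Lemma ccont_fun_of a : ccont (fun f : X => fun_of f a).
Proof. by split; exact: eval_continuous. Qed.

(** The bound replaces norm one, which pointwise limits may lose. The zero values off [B] fix one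
    representative of each functional on [B], so that compactness and extremality make sense for
    functions on [A]. *)
Definition quasi_state B phi := [/\ linear_on B phi, positive_on B phi,
  forall b, B b -> `|phi b| <= `|b| & forall a, ~ B a -> phi a = 0].

Definition restr B phi a : R[i] := if `[< B a >] then phi a else 0.

Lemma restrE B phi a : B a -> restr B phi a = phi a.
Proof. by move=> Ba; rewrite /restr asboolT. Qed.

Lemma normC_le_sqr (z : R[i]) (r : R[i]) : 0 <= r ->
  (`|z| <= r) = (z * conjc z <= r ^+ 2).
Proof. by move=> r0; rewrite -sqr_normc ler_sqr ?nnegrE. Qed.

(** As in Banach-Alaoglu, this is a closed subset of a product of segments, compact by Tychonoff's
    theorem. *)
Lemma compact_quasi_state B : compact [set f : X | quasi_state B (fun_of f)].
Proof.
pose box : set X := [set f | forall i, `[- reC `|i.2|, reC `|i.2| ]%classic (f i)].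
have cbox : compact box.
  apply: (@tychonoff _ (fun _ => R) (fun i => `[- reC `|i.2|, reC `|i.2| ]%classic)).
  by move=> i; exact: segment_compact.
apply: (subclosed_compact _ cbox); last first.
  move=> f [_ _ bd off] [s a] /=; rewrite in_itv /= -ler_norml.
  have [Ba|nBa] := pselect (B a); last first.
    have := off a nBa; rewrite /fun_of => -[h1 h2].
    have a0 : 0 <= reC `|a| by have := normr_ge0 a; rewrite lecE => /andP[].
    by case: s; rewrite ?h1 ?h2 normr0.
  rewrite -lecR RRe_real ?ger0_real// (le_trans _ (bd a Ba))//.
  rewrite normc_def lecR /= -sqrtr_sqr ler_wsqrtr//.
  by case: s; rewrite ?lerDl ?lerDr sqr_ge0.
have -> : [set f : X | quasi_state B (fun_of f)] =
  [set f | forall t : R[i] * A * A, B t.1.2 /\ B t.2 ->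
     fun_of f (t.1.1 *: t.1.2 + t.2) = t.1.1 * fun_of f t.1.2 + fun_of f t.2]
  `&` [set f | forall b, B b -> 0 <= fun_of f (star b ** b)]
  `&` [set f | forall b, B b -> fun_of f b * conjc (fun_of f b) <= `|b| ^+ 2]
  `&` [set f | forall a, ~ B a -> fun_of f a = 0].
  apply/seteqP; split => f /=.
    move=> [lin pos bd off]; do !split=> //; first by move=> [[c a] b] /= []; exact: lin.
    by move=> b Bb; rewrite -normC_le_sqr//; exact: bd.
  move=> [[[lin pos] bd] off]; split=> //.
    by move=> c a b Ba Bb; exact: (lin (c, a, b)).
  by move=> b Bb; rewrite normC_le_sqr//; exact: bd.
apply: closedI; [apply: closedI; [apply: closedI|]|]; apply: closed_forall.
- move=> [[c a] b] /= _; apply: closed_eq_ccont; first exact: ccont_fun_of.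
  apply: ccontD; last exact: ccont_fun_of.
  by apply: ccontM; [exact: ccont_cst|exact: ccont_fun_of].
- by move=> b _; apply: closed_le_ccont; [exact: ccont_cst|exact: ccont_fun_of].
- move=> b _; apply: closed_le_ccont; last exact: ccont_cst.
  by apply: ccontM; [|apply: ccontJ]; exact: ccont_fun_of.
- by move=> a _; apply: closed_eq_ccont; [exact: ccont_fun_of|exact: ccont_cst].
Qed.

End Functionals.

(** * Pure states from extreme quasi-states *)

Section PureStates.
Context {R : realType} {A : cstarAlgType R}.
Variables (B : set A) (sB : is_subspace B).
Implicit Types (a b : A) (phi psi : A -> R[i]).
Local Notation X := (prod_topology (fun _ : bool * A => R)).

Lemma normC_normc (z : R[i]) : `|z| = (Normc.normc z)%:C.
Proof. by rewrite normc_def; case: z. Qed.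

Lemma exists_phase (z : R[i]) : exists2 u : R[i], `|u| <= 1 & u * z = `|z|.
Proof.
exists (conjc z / `|z|); have [->|z0] := eqVneq z 0.
- by rewrite normr0 invr0 mulr0 normr0.
- by rewrite normrM normfV normr_id normcJ mulfV// normr_eq0.
- by rewrite normr0 mulr0.
- by rewrite mulrAC [_ * z]mulrC -sqr_normc expr2 mulfK// normr_eq0.
Qed.

Lemma linear_on0 phi : linear_on B phi -> phi 0 = 0.
Proof.
move=> lin; have := lin 1 0 0 sB.1 sB.1; rewrite scale1r addr0 mul1r => e.
by apply: (addrI (phi 0)); rewrite addr0.
Qed.

Lemma linear_onZ phi (c : R[i]) a : linear_on B phi -> B a -> phi (c *: a) = c * phi a.
Proof.
by move=> lin Ba; have := lin c a 0 Ba sB.1; rewrite (linear_on0 _ lin) !addr0.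
Qed.

Lemma linear_on_bound phi (N : R) : linear_on B phi ->
  (forall b, B b -> `|b| <= 1 -> Normc.normc (phi b) <= N) ->
  forall b, B b -> `|phi b| <= N%:C * `|b|.
Proof.
move=> lin bd b Bb; have [->|b0] := eqVneq b 0.
  by rewrite linear_on0// !normr0 mulr0.
have nb : 0 < `|b| by rewrite normr_gt0.
have bdC c : B c -> `|c| <= 1 -> `|phi c| <= N%:C.
  by move=> Bc c1; rewrite normC_normc lecR; exact: bd.
have Bb' : B (`|b|^-1 *: b) by exact: subspaceZ.
have b1 : `|(`|b|^-1 *: b)| <= 1 by rewrite normrZ normfV normr_id mulVf ?gt_eqF.
have := bdC _ Bb' b1; rewrite (linear_onZ phi (`|b|^-1) b lin Bb).
by rewrite normrM normfV normr_id ler_pdivrMl// mulrC.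
Qed.

Lemma state_bound phi : state B phi -> forall b, B b -> `|phi b| <= `|b|.
Proof.
move=> [lin _ n1] b Bb; rewrite -[leRHS]mul1r.
apply: (linear_on_bound _ 1) => // {b Bb} b Bb b1.
by rewrite -lee_fin -n1; apply: ereal_sup_ubound; exists b.
Qed.

Lemma state_approx phi (e : R) : state B phi -> 0 < e ->
  exists b, [/\ B b, `|b| <= 1 & 1 - e < Normc.normc (phi b)].
Proof.
move=> [_ _ n1] e0.
have : ((1 - e)%:E < functional_norm B phi)%E by rewrite n1 lte_fin gtrBl.
move=> /ereal_sup_gt[_ [b [Bb b1] <-]]; rewrite lte_fin => h.
by exists b.
Qed.

Lemma state_of_bound phi : linear_on B phi -> positive_on B phi ->
  (forall b, B b -> `|phi b| <= `|b|) ->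
  (forall e : R, 0 < e ->
     exists b, [/\ B b, `|b| <= 1 & 1 - e < Normc.normc (phi b)]) ->
  state B phi.
Proof.
move=> lin pos bd app; split=> //; apply/eqP; rewrite eq_le; apply/andP; split.
  apply: ge_ereal_sup => _ [b [Bb b1] <-]; rewrite lee_fin -lecR -normC_normc.
  exact: le_trans (bd b Bb) b1.
apply/lee_addgt0Pr => e e0; have [b [Bb b1 h]] := app e e0.
apply: (@le_trans _ _ ((Normc.normc (phi b))%:E + e%:E)%E).
  by rewrite -EFinD lee_fin; lra.
by rewrite leeD2r//; apply: ereal_sup_ubound; exists b.
Qed.

Lemma quasi_state_restr phi : state B phi ->
  (forall a b, B a -> B b -> B (a ** b)) -> (forall a, B a -> B (star a)) ->
  quasi_state B (restr B phi).
Proof.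
move=> st mB stB; have bd := state_bound _ st; have [lin pos _] := st.
split=> [c a b Ba Bb|b Bb|b Bb|a nBa].
- rewrite !restrE//; first exact: lin.
  exact: sB.2.
- by rewrite restrE; [exact: pos|apply: mB => //; exact: stB].
- by rewrite restrE//; exact: bd.
- by rewrite /restr asboolF.
Qed.

Lemma quasi_state0 : quasi_state B (fun=> 0).
Proof.
split=> [c a b _ _|b _|b _|//]; by rewrite ?mulr0 ?addr0 ?normr0.
Qed.

Lemma quasi_stateZ psi (N : R) : 0 < N -> quasi_state B psi ->
  (forall b, B b -> `|psi b| <= N%:C * `|b|) ->
  quasi_state B (fun b => N^-1%:C * psi b).
Proof.
move=> N0 [lin pos _ off] bd; have N0' : 0 < N^-1%:C by rewrite ltcR invr_gt0.
split=> [c a b Ba Bb|b Bb|b Bb|a nBa].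
- by rewrite lin// mulrDr mulrCA.
- by rewrite mulr_ge0 ?pos// ltW.
- rewrite normrM (gtr0_norm N0') fmorphV ler_pdivrMl ?ltcR//; exact: bd.
- by rewrite off// mulr0.
Qed.

Hypothesis mB : forall a b, B a -> B b -> B (a ** b).
Hypothesis stB : forall a, B a -> B (star a).

(* An extreme point of the compact set of quasi-states, other than [0], has
   norm one. *)
Lemma exists_pure_state_gt0 phi b : state B phi -> B b -> 0 < reC (phi b) ->
  exists2 psi, pure_state B psi & reC (phi b) <= reC (psi b).
Proof.
move=> st Bb phib0.
pose Q : set X := [set f | quasi_state B (fun_of f)].
have Qphi : Q (coords (restr B phi)).
  by rewrite /Q /= coordsK; exact: quasi_state_restr.
have [||f [Qf fext] fmax] := compact_extreme_max Q (true, b).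
- by exists (coords (restr B phi)).
- exact: compact_quasi_state.
pose psi := fun_of f; have [lin pos bd off] : quasi_state B psi := Qf.
have psib : reC (phi b) <= reC (psi b).
  by have := fmax _ Qphi; rewrite /coords /= restrE.
exists psi => //.
have psib0 : 0 < reC (psi b) by exact: lt_le_trans phib0 psib.
have ext g h (t : R) : quasi_state B g -> quasi_state B h -> 0 < t < 1 ->
    (forall a, psi a = t%:C * g a + (1 - t)%:C * h a) -> g = psi /\ h = psi.
  move=> Qg Qh t01 e.
  have [||||gE hE] := fext (coords g) (coords h) t; rewrite ?/Q /= ?coordsK//.
    move=> [s a]; have := e a; rewrite /psi /fun_of /coords /=.
    case: (g a) => g1 g2; case: (h a) => h1 h2 /=.
    by simpc => -[e1 e2]; case: s.
  by rewrite /psi; split; [rewrite -gE|rewrite -hE]; rewrite coordsK.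
pose S := [set Normc.normc (psi b) | b in [set b | B b /\ `|b| <= 1]].
have Sub : ubound S 1.
  by move=> _ [a [Ba a1] <-]; rewrite -lecR -normC_normc; exact: le_trans (bd a Ba) a1.
have S0 : S !=set0.
  by exists (Normc.normc (psi 0)), 0 => //; split; [exact: sB.1|rewrite normr0].
have hS : has_sup S by split=> //; exists 1.
set N := sup S in hS.
have SN a : B a -> `|a| <= 1 -> Normc.normc (psi a) <= N.
  by move=> Ba a1; apply: ub_le_sup; [exact: hS.2|exists a].
have N1 : N <= 1 by exact: ge_sup.
have bdN := linear_on_bound psi N lin SN.
have N0 : 0 < N.
  rewrite ltNge; apply/negP => N0; have : `|psi b| <= 0.
    by rewrite (le_trans (bdN b Bb))// mulr_le0_ge0// -(rmorph0 (real_complex R)) lecR.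
  by rewrite normr_le0 => /eqP e; move: psib0; rewrite e ltxx.
have NE : N = 1.
  (* If [N < 1], then [psi] is the combination of [psi / N] and [0] with weights [N] and [1 - N], so
     extremality gives [psi = 0]. *)
  apply/eqP; rewrite eq_le N1 leNgt; apply/negP => Nlt1.
  have [] := ext (fun a => N^-1%:C * psi a) (fun=> 0) N.
  - exact: quasi_stateZ.
  - exact: quasi_state0.
  - by rewrite N0.
  - move=> a; rewrite mulr0 addr0 mulrA -rmorphM divff ?mul1r ?gt_eqF//.
  - by move=> _ e; move: psib0; rewrite -e ltxx.
have st' : state B psi.
  apply: state_of_bound => // e e0.
  have [_ [a [Ba a1] <-]] := sup_adherent e0 hS; rewrite -/N NE => h.
  by exists a.
(* Restricted states are quasi-states, and the decomposition on [B] extends by zero. *)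
split=> // psi1 psi2 t st1 st2 t01 e a Ba.
have [||||h1 h2] := ext (restr B psi1) (restr B psi2) t.
- exact: quasi_state_restr.
- exact: quasi_state_restr.
- by [].
- move=> c; have [Bc|nBc] := pselect (B c); first by rewrite !restrE// e.
  by rewrite /restr asboolF// !mulr0 addr0 off.
by split; [rewrite -h1|rewrite -h2]; rewrite restrE.
Qed.

Lemma re_le_norm (z : R[i]) (r : R) : `|z| <= r%:C -> reC z <= r.
Proof.
rewrite -lecR; apply: le_trans; apply: le_trans (normc_ge_Re z).
by rewrite lecR ler_norm.
Qed.

(* The constraint [0 < reC (phi b)] is removed by adding to [b] a multiple of
   an almost norming element. *)
Lemma exists_pure_state phi b (e : R) : state B phi -> B b -> 0 < e ->
  exists2 psi, pure_state B psi & reC (phi b) - e <= reC (psi b).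
Proof.
move=> st Bb e0; have [lin _ _] := st.
(* With [lam * d <= 1 / 2], the real part of [phi] at [lam%:C *: a + b] exceeds [1 / 2]; with
   [lam * d <= e], the final loss is at most [e]. *)
pose lam := `|reC (phi b)| + 1.
have lam0 : 0 < lam by rewrite ltr_wpDl.
pose d := Num.min e (1 / 2) / lam.
have m0 : 0 < Num.min e (1 / 2) by rewrite lt_min e0 divr_gt0.
have dl : lam * d = Num.min e (1 / 2) by rewrite mulrC divfK// gt_eqF.
have d0 : 0 < d by rewrite divr_gt0.
have [b0 [Bb0 nb0 h0]] := state_approx _ _ st d0.
have [u u1 uz] := exists_phase (phi b0).
pose a := u *: b0.
have Ba : B a by exact: subspaceZ.
have a1 : `|a| <= 1 by rewrite normrZ mulr_ile1.
have lE psi : linear_on B psi ->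
    reC (psi (lam%:C *: a + b)) = lam * reC (psi a) + reC (psi b).
  move=> lpsi; rewrite lpsi//; case: (psi a) => x1 x2; case: (psi b) => y1 y2 /=.
  by rewrite mul0r subr0.
have phia : 1 - d < reC (phi a).
  by rewrite linear_onZ// uz normC_normc.
have hm1 : Num.min e (1 / 2) <= e by rewrite ge_min lexx.
have hm2 : Num.min e (1 / 2) <= 1 / 2 by rewrite ge_min lexx orbT.
have h : lam * (1 - d) < lam * reC (phi a) by rewrite ltr_pM2l.
have hn : - `|reC (phi b)| <= reC (phi b) by rewrite lerNl -normrN ler_norm.
have [||psi pst] := exists_pure_state_gt0 phi (lam%:C *: a + b) st.
- exact: sB.2.
- by rewrite lE//; move: h; rewrite mulrBr mulr1 dl {1}/lam; lra.
rewrite !lE//; last by have [[]] := pst.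
move=> hpsi; exists psi => //.
have : lam * reC (psi a) <= lam * 1.
  rewrite ler_pM2l//; apply: re_le_norm.
  rewrite (le_trans (state_bound _ pst.1 _ Ba))//.
by move: h hpsi; rewrite mulrBr mulr1 dl; lra.
Qed.

End PureStates.

(** * States of the unital algebra *)

Section StatesUnital.
Context {R : realType} {A : cstarAlgType R}.
Implicit Types (a b : A) (phi psi : A -> R[i]).
Local Notation X := (prod_topology (fun _ : bool * A => R)).

Lemma subspace_setT : is_subspace [set: A].
Proof. by []. Qed.

(** [1 - star a ** a] is the square of a self-adjoint element by [exists_sqrt]. *)
Lemma positive_sqr_le phi a : linear_on [set: A] phi -> positive_on [set: A] phi ->
  `|a| <= 1 -> phi (star a ** a) <= phi cone.
Proof.
move=> lin pos a1.
have sx : star (cone - star a ** a) = cone - star a ** a.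
  by rewrite starB star_cone starM starK.
have [|y [sy yy _ _ _]] := exists_sqrt _ sx.
  by rewrite opprB addrCA subrr addr0 cnorm_star exprn_ile1.
have := pos y I; rewrite sy yy addrC -scaleN1r lin// mulN1r addrC subr_ge0.
exact.
Qed.

(* Positivity of [phi] at [1 - a] and [1 - 'i a], the polarization behind the
   Cauchy-Schwarz inequality. *)
Lemma positive_real_le phi a : linear_on [set: A] phi -> positive_on [set: A] phi ->
  `|a| <= 1 -> reC (phi a) <= reC (phi cone).
Proof.
move=> lin pos a1.
have exp (u : R[i]) : phi (star (cone - u *: a) ** (cone - u *: a)) =
    phi cone - u * phi a - conjc u * phi (star a) + conjc u * u * phi (star a ** a).
  rewrite starB star_cone starZ cmulBl cmul1l !cmulBr cmul1r !cmulZl !cmulZr.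
  rewrite scalerA opprB.
  have -> : cone - u *: a + ((conjc u * u) *: (star a ** a) - conjc u *: star a) =
    (conjc u * u) *: (star a ** a) + ((- conjc u) *: star a + ((- u) *: a + cone)).
    by rewrite !scaleNr addrC -addrA [- (u *: a) + cone]addrC.
  by rewrite !lin//; ring.
have h0 := pos cone I; rewrite star_cone cmul1l in h0.
have ha := pos a I.
have h1 := pos (cone - 1 *: a) I; rewrite exp in h1.
(* The vanishing imaginary parts make the real parts of [phi a] and [phi (star a)] equal; [h1] then
   bounds twice that real part by [phi cone + phi (star a ** a)], hence by [2 * phi cone]. *)
have h2 := pos (cone - (0 +i* 1) *: a) I; rewrite exp in h2.
have := positive_sqr_le _ _ lin pos a1.
move: h0 ha h1 h2.
case: (phi cone) => x1 x2; case: (phi a) => y1 y2; case: (phi (star a)) => z1 z2.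
case: (phi (star a ** a)) => w1 w2; rewrite !lecE /=.
do ![case/andP => /eqP ? ?]; lra.
Qed.

(** The norm bound gives one inequality. For the other, an almost norming element is rotated by a
    phase to have a real value, which [phi cone] dominates. *)
Lemma state_cone phi : state [set: A] phi -> phi cone = 1.
Proof.
move=> st; have bd := state_bound _ subspace_setT _ st; have [lin pos _] := st.
have h0 := pos cone I; rewrite star_cone cmul1l in h0.
apply/le_anti/andP; split.
  by rewrite -(ger0_norm h0) (le_trans (bd _ I))// norm_cone.
have [x xE] : exists x, phi cone = x%:C.
  by exists (reC (phi cone)); rewrite RRe_real// ger0_real.
rewrite xE -(rmorph1 (real_complex R)) lecR; apply/ler_addgt0Pr => e e0.
have [a [_ a1 h]] := state_approx _ _ _ st e0.
have [u u1 uz] := exists_phase (phi a).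
have ua1 : `|u *: a| <= 1 by rewrite normrZ mulr_ile1.
have := positive_real_le _ _ lin pos ua1.
rewrite (linear_onZ [set: A] subspace_setT phi u a lin I) uz normC_normc xE /=; lra.
Qed.

(** Replaces the supremum in the norm by a condition visibly closed under pointwise limits, whence
    the states form a compact set. *)
Lemma state_unitalP phi :
  state [set: A] phi <-> quasi_state [set: A] phi /\ phi cone = 1.
Proof.
split=> [st|[[lin pos bd _] e1]].
  split; last exact: state_cone.
  have [lin pos _] := st.
  split=> // [b _|a []//].
  exact: (state_bound _ subspace_setT _ st _ I).
apply: state_of_bound => // e e0; exists cone; split=> //; first exact: norm_cone.
by rewrite e1 Normc.normc1 gtrBl.
Qed.

Definition mix (t : R) phi psi a : R[i] := (1 - t)%:C * phi a + t%:C * psi a.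

Lemma fun_of_mix (f g : X) (t : R) :
  fun_of ((fun i => (1 - t) * f i + t * g i) : X) = mix t (fun_of f) (fun_of g).
Proof. by apply/funext => a; rewrite /mix /fun_of; simpc. Qed.

Lemma quasi_state_mix (B : set A) phi psi (t : R) : 0 <= t <= 1 ->
  quasi_state B phi -> quasi_state B psi -> quasi_state B (mix t phi psi).
Proof.
move=> /andP[t0 t1] [lin pos bd off] [lin' pos' bd' off'].
have t0' : 0 <= t%:C by rewrite lecR.
have t1' : 0 <= (1 - t)%:C by rewrite lecR subr_ge0.
split=> [c a b Ba Bb|b Bb|b Bb|a nBa].
- by rewrite /mix lin// lin'//; ring.
- by rewrite /mix addr_ge0// mulr_ge0// ?pos ?pos'.
- rewrite /mix (le_trans (ler_normD _ _))// !normrM (ger0_norm t0') (ger0_norm t1').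
  have -> : `|b| = (1 - t)%:C * `|b| + t%:C * `|b|.
    by rewrite -mulrDl -rmorphD subrK mul1r.
  by rewrite lerD// ler_wpM2l// ?bd ?bd'.
- by rewrite /mix off// off'// !mulr0 addr0.
Qed.

Lemma state_mix phi psi (t : R) : 0 <= t <= 1 ->
  state [set: A] phi -> state [set: A] psi -> state [set: A] (mix t phi psi).
Proof.
move=> t01 /state_unitalP[q1 e1] /state_unitalP[q2 e2]; apply/state_unitalP.
split; first exact: quasi_state_mix.
by rewrite /mix e1 e2 !mulr1 -rmorphD subrK.
Qed.

End StatesUnital.

(** * The sandwich inequalities *)

Section Sandwich.
Context {R : realType} {A : cstarAlgType R} {E : hilbertModType A}.
Variables (F : set E) (hF : ternary F) (m M : R).
Hypothesis M0 : 0 < M.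
Implicit Types (phi psi : A -> R[i]).
Local Notation X := (prod_topology (fun _ : bool * A => R)).
Local Notation B := (inner_span F).

(** The complex root is replaced by the real root of the real part, which depends continuously on
    the coordinates. *)
Definition real_sandwich psi phi := forall x, F x ->
  m%:C * psi (module_abs x) <= phi (module_abs x) /\
  phi (module_abs x) <= (M * Num.sqrt (reC (psi (module_abs x ** module_abs x))))%:C.

Lemma sqrtC_real (z : R[i]) : 0 <= z -> sqrtC z = (Num.sqrt (reC z))%:C.
Proof.
move=> z0; have zr : z = (reC z)%:C by rewrite RRe_real// ger0_real.
rewrite {1}zr -[in LHS](sqr_sqrtr (_ : 0 <= reC z)) -?lecR -?zr// rmorphXn.
by rewrite sqrCK// lecR sqrtr_ge0.
Qed.

Lemma positive_module_abs_sqr psi x : positive_on B psi -> F x ->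
  0 <= psi (module_abs x ** module_abs x).
Proof.
move=> pos Fx; rewrite -{1}star_module_abs; apply: pos.
exact: (module_abs_sqr_mem _ hF _ Fx).2.
Qed.

Lemma real_sandwichP psi phi : positive_on B psi ->
  state_sandwich m M F psi phi <-> real_sandwich psi phi.
Proof.
move=> pos; split=> h x Fx; have [h1 h2] := h x Fx; split=> //.
  by rewrite rmorphM /= -sqrtC_real//; exact: positive_module_abs_sqr.
by move: h2; rewrite rmorphM /= -sqrtC_real//; exact: positive_module_abs_sqr.
Qed.

Lemma closed_real_sandwich (Y : topologicalType) (Psi Phi : Y -> A -> R[i]) :
  (forall a, ccont (fun y => Psi y a)) -> (forall a, ccont (fun y => Phi y a)) ->
  closed [set y | real_sandwich (Psi y) (Phi y)].
Proof.
move=> cPsi cPhi; apply: closed_forall => x Fx; apply: closedI.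
  apply: closed_le_ccont => //.
  by apply: ccontM => //; exact: ccont_cst.
apply: closed_le_ccont => //; apply: ccont_real => y.
pose u y := Num.sqrt (reC (Psi y (module_abs x ** module_abs x))).
have cu : {for y, continuous u}.
  apply: (@continuous_comp _ _ _ (fun y => reC (Psi y (module_abs x ** module_abs x)))).
    exact: (cPsi _).1.
  exact: sqrt_continuous.
exact: (@continuousM _ _ (cst M) u y (@cst_continuous _ _ M y) cu).
Qed.

(** The squares of the two sides differ by [t * (1 - t)] times the square of
    [Num.sqrt u - Num.sqrt v]. *)
Lemma sqrt_concave (t u v : R) : 0 <= t <= 1 -> 0 <= u -> 0 <= v ->
  (1 - t) * Num.sqrt u + t * Num.sqrt v <= Num.sqrt ((1 - t) * u + t * v).
Proof.
move=> /andP[t0 t1] u0 v0.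
have t1' : 0 <= 1 - t by rewrite subr_ge0.
rewrite -[leLHS]ger0_norm ?addr_ge0 ?mulr_ge0 ?sqrtr_ge0// -sqrtr_sqr ler_wsqrtr//.
rewrite -{2}(sqr_sqrtr u0) -{2}(sqr_sqrtr v0).
move: (Num.sqrt u) (Num.sqrt v) => x y.
have := mulr_ge0 (mulr_ge0 t0 t1') (sqr_ge0 (x - y)); lra.
Qed.

(** The lower inequality is linear in the pair of functionals; the upper one survives by concavity
    of the square root. *)
Lemma real_sandwich_mix psi psi' phi phi' (t : R) : 0 <= t <= 1 ->
  positive_on B psi -> positive_on B psi' ->
  real_sandwich psi phi -> real_sandwich psi' phi' ->
  real_sandwich (mix t psi psi') (mix t phi phi').
Proof.
move=> t01 pos pos' h h' x Fx; have /andP[t0 t1] := t01.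
have t0' : 0 <= t%:C by rewrite lecR.
have t1' : 0 <= (1 - t)%:C by rewrite lecR subr_ge0.
have [h1 h2] := h x Fx; have [h1' h2'] := h' x Fx; split.
  rewrite /mix mulrDr 2![m%:C * _]mulrCA.
  by rewrite lerD// ler_wpM2l.
rewrite /mix (le_trans (lerD (ler_wpM2l t1' h2) (ler_wpM2l t0' h2')))//.
rewrite -!rmorphM -rmorphD lecR.
have := positive_module_abs_sqr _ x pos Fx; have := positive_module_abs_sqr _ x pos' Fx.
case: (psi _) => u u'; case: (psi' _) => v v'; rewrite !lecE /= => /andP[_ v0] /andP[_ u0].
rewrite !mul0r !subr0.
have := sqrt_concave _ _ _ t01 u0 v0; rewrite -(ler_pM2l M0); lra.
Qed.

Lemma compact_sandwich_states psi : state B psi ->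
  compact [set f : X | state [set: A] (fun_of f) /\ state_sandwich m M F psi (fun_of f)].
Proof.
move=> [_ pos _].
have -> : [set f : X | state [set: A] (fun_of f) /\ state_sandwich m M F psi (fun_of f)] =
    [set f : X | quasi_state [set: A] (fun_of f)] `&`
    ([set f : X | fun_of f cone = 1] `&` [set f | real_sandwich psi (fun_of f)]).
  apply/seteqP; split => f /=.
    by move=> [/state_unitalP[q e] /(real_sandwichP _ _ pos) s].
  by move=> [q [e s]]; split; [exact/state_unitalP|exact/(real_sandwichP _ _ pos)].
apply: compact_closedI; first exact: compact_quasi_state.
apply: closedI.
  by apply: closed_eq_ccont; [exact: ccont_fun_of|exact: ccont_cst].
by apply: closed_real_sandwich => a; [exact: ccont_cst|exact: ccont_fun_of].
Qed.

Lemma sandwich_states_mix psi phi phi' (t : R) : 0 <= t <= 1 -> state B psi ->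
  state [set: A] phi /\ state_sandwich m M F psi phi ->
  state [set: A] phi' /\ state_sandwich m M F psi phi' ->
  state [set: A] (mix t phi phi') /\ state_sandwich m M F psi (mix t phi phi').
Proof.
move=> t01 [_ pos _] [st s] [st' s']; split; first exact: state_mix.
move: s s'; rewrite !real_sandwichP// => s s'.
have := real_sandwich_mix _ _ _ _ _ t01 pos pos s s'.
suff -> : mix t psi psi = psi by [].
by apply/funext => a; rewrite /mix -mulrDl -rmorphD subrK mul1r.
Qed.

Lemma star_inner_span a : B a -> B (star a).
Proof.
have [sB cB _] := inner_span_subalgebra _ hF.
move=> Ba; apply: (@closed_span_min _ _ _ [set z | B (star z)] _ _ _ a Ba).
- split=> /=; first by rewrite star0; exact: sB.1.
  by move=> c u v Bu Bv; rewrite starD starZ; exact: sB.2.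
- apply: (@closed_preimage_lipschitz _ _ _ _ 1) => // u v.
  by rewrite -starB norm_star mul1r.
- move=> _ [[u v] [/= Fu Fv] <-]; rewrite inner_star; apply: sub_closed_span.
  by exists (v, u).
Qed.

(* The states [psi] admitting a [phi] form a compact convex set containing the
   pure states. *)
Lemma sandwich_of_pure (P : set (A -> R[i])) :
  compact [set f : X | P (fun_of f)] ->
  (forall phi phi' (t : R), 0 <= t <= 1 -> P phi -> P phi' -> P (mix t phi phi')) ->
  (forall psi, pure_state B psi -> exists2 phi, P phi & state_sandwich m M F psi phi) ->
  forall psi, state B psi -> exists2 phi, P phi & state_sandwich m M F psi phi.
Proof.
move=> cP convP pureP psi st.
have [sB cB mB] := inner_span_subalgebra _ hF.
(* The inequalities are closed in the pair, so the admissible pairs form a compact set, and so does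
   its projection [T]. Quasi-states stand in for states on [B] to have compactness in the first
   component. *)
pose W : set (X * X) :=
  ([set f : X | quasi_state B (fun_of f)] `*` [set f : X | P (fun_of f)]) `&`
  [set y | real_sandwich (fun_of y.1) (fun_of y.2)].
have cW : compact W.
  apply: compact_closedI; first by apply: compact_setX => //; exact: compact_quasi_state.
  apply: closed_real_sandwich => a.
    by split=> y; apply: (@continuous_comp _ _ _ fst (fun f : X => f (_, a)));
      [exact: cvg_fst|exact: eval_continuous|exact: cvg_fst|exact: eval_continuous].
  by split=> y; apply: (@continuous_comp _ _ _ snd (fun f : X => f (_, a)));
    [exact: cvg_snd|exact: eval_continuous|exact: cvg_snd|exact: eval_continuous].
pose T : set X := [set y.1 | y in W].
have cT : compact T.
  apply: continuous_compact => //; apply: continuous_subspaceT => y; exact: cvg_fst.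
have convT : convex_fun_set T.
  move=> _ _ t [[f g] [[/= Qf Pg] s] <-] [[f' g'] [[/= Qf' Pg'] s'] <-] t01.
  exists ((fun i => (1 - t) * f i + t * f' i) : X,
          (fun i => (1 - t) * g i + t * g' i) : X) => //.
  split; [split|]; rewrite /= ?fun_of_mix.
  - exact: quasi_state_mix.
  - exact: convP.
  - by apply: real_sandwich_mix => //; [case: Qf|case: Qf'].
have [|f [[f1 g] [[/= Qf Pg] s] fE] fpsi] := compact_convex_agree T (coords psi)
    [set i | B i.2] cT convT.
  move=> l c e lB e0.
  (* A real combination of coordinates is the real part of the value at one element of [B]: the
     factor [0 -i* c i] moves the imaginary part to the real one. *)
  pose b := \sum_(i <- l) (if i.1 then (c i)%:C else (0 -i* c i)) *: i.2.
  have bE tau : linear_on B tau -> B b /\ reC (tau b) = \sum_(i <- l) c i * coords tau i.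
    move=> lin; rewrite /b; elim: l lB {b} => [|[s0 a] l IH] lB.
      by rewrite !big_nil (linear_on0 B)//; split=> //; exact: sB.1.
    have [Bb IHe] := IH (fun i il => lB i (mem_behead (s := _ :: _) il)).
    have Ba : B a by apply: (lB (s0, a)); rewrite mem_head.
    rewrite !big_cons; split; first exact: sB.2.
    rewrite lin//= raddfD /= IHe; congr (_ + _); rewrite /coords /=.
    by case: (tau a) => z1 z2; case: s0 {lB}; rewrite /= !mul0r ?subr0 ?sub0r ?mulNr ?opprK.
  have [lin _ _] := st; have [Bb pb] := bE _ lin.
  have [tau pt ht] := exists_pure_state B sB mB star_inner_span psi b e st Bb e0.
  have [phi Pphi sphi] := pureP _ pt.
  have [[lint post _] _] := pt.
  exists (coords (restr B tau)).
    exists (coords (restr B tau), coords phi) => //; split; first split; rewrite /= ?coordsK//.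
      exact: quasi_state_restr pt.1 mB star_inner_span.
    move=> x Fx; have [B2 B1] := module_abs_sqr_mem _ hF x Fx.
    have /(real_sandwichP _ _ post)/(_ x Fx) := sphi.
    by rewrite !restrE.
  rewrite -pb; apply: le_trans ht _; rewrite (bE _ lint).2.
  rewrite le_eqVlt; apply/orP; left; apply/eqP; rewrite big_seq [RHS]big_seq.
  by apply: eq_bigr => i /lB /= Bi; rewrite /coords restrE.
subst f; exists (fun_of g) => //.
have [_ pos _] := st; apply/real_sandwichP => // x Fx.
have [B2 B1] := module_abs_sqr_mem _ hF x Fx.
(* [f1] matches [psi] only on [B], which contains the absolute values and their squares. *)
have E1 a : B a -> fun_of f1 a = psi a.
  move=> Ba; rewrite /fun_of (fpsi (true, a) Ba) (fpsi (false, a) Ba) /coords /=.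
  by case: (psi a).
by have := s x Fx; rewrite !E1.
Qed.

End Sandwich.

Theorem theorem2p9 (R : realType) (A : cstarAlgType R) (E : hilbertModType A)
    (E1 E2 : set E) (hE1 : ternary E1) (hE2 : ternary E2) :
  module_independent E1 E2 <->
  exists m M : R, [/\ 0 < m, 0 < M &
    forall phi1 phi2 : A -> R[i],
      pure_state (inner_span E1) phi1 -> pure_state (inner_span E2) phi2 ->
      exists phi : A -> R[i],
        [/\ state [set: A] phi,
            state_sandwich m M E1 phi1 phi & state_sandwich m M E2 phi2 phi]].
Proof.
split=> -[m [M [m0 M0 H]]]; exists m, M; split=> // phi1 phi2.
  by move=> [st1 _] [st2 _]; exact: H.
move=> st1 st2.
(* The first state is already arbitrary here while the second stays pure, its inequalities being
   kept in the compact convex set [P]. *)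
have step1 psi2 : pure_state (inner_span E2) psi2 -> exists2 phi,
    state [set: A] phi /\ state_sandwich m M E1 phi1 phi &
    state_sandwich m M E2 psi2 phi.
  move=> pst2; have [stp2 _] := pst2.
  have [||psi1 pst1|phi [st s2] s1] := sandwich_of_pure E1 hE1 m M M0
      (fun phi => state [set: A] phi /\ state_sandwich m M E2 psi2 phi) _ _ _ phi1 st1.
  - exact: compact_sandwich_states.
  - by move=> phi phi' t t01; exact: sandwich_states_mix.
  - by have [phi [st s1 s2]] := H _ _ pst1 pst2; exists phi.
  - by exists phi.
(* Now the inequalities for the fixed [phi1] are kept in [P], and the second state becomes
   arbitrary. *)
have [||phi [st s1] s2] := sandwich_of_pure E2 hE2 m M M0
    (fun phi => state [set: A] phi /\ state_sandwich m M E1 phi1 phi) _ _ step1 phi2 st2.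
- exact: compact_sandwich_states.
- by move=> phi phi' t t01; exact: sandwich_states_mix.
by exists phi; split.
Qed.
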